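(* Let $a=t_0<t_1<\cdots<t_m=b$ be a partition of $[a,b]$ and let $x_0,x_1,\ldots,x_m\in\mathbb{R}^n$ be fixed. Let $A(t)$ and $B(t)$ be real $n\times n$ matrix functions on $[a,b]$ such that (H1) $B(t)$ has full rank (is nonsingular) for every $t$; (H2) the control system $\dot x(t)=A(t)x(t)+B(t)u(t)$ is completely state controllable; (H3) $t\mapsto A(t)$ and $t\mapsto B(t)$ are $C^1$-smooth. Consider the optimal control problem $(P)$: \[\min_{u(\cdot)}\ J[u(\cdot)]=\int_a^b\langle B(t)u(t),B(t)u(t)\rangle\,dt\] subject to $\dot x(t)=A(t)x(t)+B(t)u(t)$ and $x(t_i)=x_i$ for $i=0,1,\ldots,m$, with unrestricted control $u:[a,b]\to\mathbb{R}^n$ and absolutely continuous state $x:[a,b]\to\mathbb{R}^n$. Let $\Phi(t,s)$ be the state transition matrix of $\dot x=A(t)x$, and for each $i=0,\ldots,m-1$ let $S=\int_{t_i}^{t_{i+1}}\Phi(t_i,s)\Phi(t_i,s)'\,ds$ (a symmetric matrix). Then the optimal state trajectory of $(P)$ has, in each interval $[t_i,t_{i+1}]$, $i=0,1,\ldots,m-1$, the explicit expression \[x(t)=\Phi(t,t_i)x_i+\left(\int_{t_i}^{t}\Phi(t,s)\Phi(t_i,s)'\,ds\right)S^{-1}\big(\Phi(t_i,t_{i+1})x_{i+1}-x_i\big),\] and the optimal control of $(P)$ has, in each interval $[t_i,t_{i+1}]$, the explicit expression \[u(t)=B(t)^{-1}\Phi(t_i,t)'\,S^{-1}\big(\Ph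i(t_i,t_{i+1})x_{i+1}-x_i\big).\]
   Context: $\langle\cdot,\cdot\rangle$ is the Euclidean inner product on $\mathbb{R}^n$ and a prime ${}'$ denotes transpose. The state transition matrix $\Phi(t,s)$ is the matrix with $\frac{\partial}{\partial t}\Phi(t,s)=A(t)\Phi(t,s)$ and $\Phi(s,s)=I$. *)

(* Defs.v *)
From HB Require Import structures.
From mathcomp Require Import all_boot all_order all_algebra.
From mathcomp Require Import all_classical all_reals all_analysis.
Set Implicit Arguments. Unset Strict Implicit. Unset Printing Implicit Defensive.
Import Order.TTheory GRing.Theory Num.Theory.
Import numFieldNormedType.Exports.
Local Open Scope classical_set_scope.
Local Open Scope ring_scope.

Section Defs.
Variable R : realType.
Variable n : nat.

Definition abs_cont_on (a b : R) (f : R -> R) : Prop :=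
  forall eps : R, 0 < eps -> exists2 del : R, 0 < del &
    forall (N : nat) (l r : 'I_N -> R),
      (forall k, a <= l k /\ l k <= r k /\ r k <= b) ->
      (forall k k', k != k' -> r k <= l k' \/ r k' <= l k) ->
      \sum_(k < N) (r k - l k) < del ->
      \sum_(k < N) `|f (r k) - f (l k)| < eps.

Definition C1_on (a b : R) (f : R -> R) : Prop :=
  {within `[a, b], continuous f} /\
  (forall t, a < t < b -> derivable f t 1) /\
  exists2 g : R -> R, {within `[a, b], continuous g} &
    forall t, a < t < b -> derive1 f t = g t.

Definition mx_C1_on (a b : R) (F : R -> 'M[R]_n) : Prop :=
  forall i j, C1_on a b (fun t => F t i j).

Definition transition_matrix (A : R -> 'M[R]_n) (a b : R)
    (Phi : R -> R -> 'M[R]_n) : Prop :=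
  forall s, a <= s <= b ->
    Phi s s = 1%:M /\
    forall i j,
      {within `[a, b], continuous (fun t => Phi t s i j)} /\
      forall t, a < t < b ->
        derivable (fun r => Phi r s i j) t 1 /\
        derive1 (fun r => Phi r s i j) t = (A t *m Phi t s) i j.

Definition solves (A B : R -> 'M[R]_n) (a b : R)
    (x u : R -> 'cV[R]_n) : Prop :=
  (forall k, measurable_fun `[a, b] (fun t => u t k 0)) /\
  (forall k, abs_cont_on a b (fun t => x t k 0)) /\
  {ae (@lebesgue_measure R), forall t, a <= t <= b ->
     forall k, derivable (fun s => x s k 0) t 1 /\
       derive1 (fun s => x s k 0) t = (A t *m x t + B t *m u t) k 0}.

Definition controllable (A B : R -> 'M[R]_n) (a b : R) : Prop :=
  forall x0 x1 : 'cV[R]_n, exists x u, solves A B a b x u /\ x a = x0 /\ x b = x1.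

Definition cost (B : R -> 'M[R]_n) (a b : R) (u : R -> 'cV[R]_n) : \bar R :=
  (\int[@lebesgue_measure R]_(t in `[a, b])
     (\sum_(k < n) ((B t *m u t) k 0) ^+ 2)%:E)%E.

Definition mx_integral (a b : R) (F : R -> 'M[R]_n) : 'M[R]_n :=
  \matrix_(i, j) Rintegral (@lebesgue_measure R) `[a, b] (fun s => F s i j).

Definition admissible (A B : R -> 'M[R]_n) (m : nat) (tp : nat -> R)
    (xp : nat -> 'cV[R]_n) (x u : R -> 'cV[R]_n) : Prop :=
  solves A B (tp 0%N) (tp m) x u /\ forall i, (i <= m)%N -> x (tp i) = xp i.

Definition optimal (A B : R -> 'M[R]_n) (m : nat) (tp : nat -> R)
    (xp : nat -> 'cV[R]_n) (x u : R -> 'cV[R]_n) : Prop :=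
  admissible A B m tp xp x u /\
  forall y v, admissible A B m tp xp y v ->
    (cost B (tp 0%N) (tp m) u <= cost B (tp 0%N) (tp m) v)%E.

End Defs.

(* Main.v *)
(* With w = B u the cost is the squared L2 norm of w.  The costate
   w0(t) = Phi(t_i, t)^T c_i satisfies dw0/dt = - A^T w0, so for the difference
   d of two trajectories, with inputs w and w0, d/dt <w0, d> = <w0, w - w0>
   almost everywhere.  As d vanishes at the nodes, w - w0 is orthogonal to w0
   on each piece, and Pythagoras yields both optimality and uniqueness.  The
   integration step is the fundamental theorem of calculus for absolutely
   continuous functions, which follows from Cousin's covering argument. *)

Require Import Defs.
From HB Require Import structures.
From mathcomp Require Import all_boot all_order all_algebra.
From mathcomp Require Import all_classical all_reals all_analysis.
From mathcomp Require Import measurable_realfun ring lra.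
Set Implicit Arguments. Unset Strict Implicit. Unset Printing Implicit Defensive.
Import Order.TTheory GRing.Theory Num.Theory.
Import numFieldNormedType.Exports.
Local Open Scope classical_set_scope.
Local Open Scope ring_scope.

(** The form of the costate is forced. The inputs w that steer x_i to x_{i+1} are those whose
    integral of Phi(t_i, s) w(s) over the piece equals Phi(t_i, t_{i+1}) x_{i+1} - x_i. The one of
    least norm lies in the range of the adjoint map c -> Phi(t_i, .)^T c, and substituting it leaves
    S c_i = Phi(t_i, t_{i+1}) x_{i+1} - x_i. As the state is prescribed at every node, the pieces do
    not interact. Two obstacles shape the proof. A competing trajectory obeys its equation only
    almost everywhere, with a control that is merely measurable, so classical uniqueness for
    differential equations does not reach it; comparisons go through scalar pairings with costates
    instead. Moreover [transition_matrix] constrains Phi in its first argument only, whereas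
    costates move the second, so their regularity has to come from matrix inversion. *)

Local Notation mu := lebesgue_measure.

(* The [Filter] instance for [{ae _, _}] is not inferred for the bare
   [lebesgue_measure], which is not displayed on [measurableTypeR R]. *)
Lemma ae_lebesgue_filter (R : realType) :
  Filter (almost_everywhere (@lebesgue_measure R)).
Proof.
exact: (@ae_filter_ringOfSetsType _ (measurableTypeR R) R lebesgue_measure).
Qed.

Lemma ae_lebesgue1 (R : realType) (P S : R -> Prop) :
  (forall t, P t -> S t) ->
  {ae (@lebesgue_measure R), forall t, P t} ->
  {ae (@lebesgue_measure R), forall t, S t}.
Proof. by move=> PS; apply: (@filterS _ _ (ae_lebesgue_filter R)). Qed.

Lemma ae_lebesgue2 (R : realType) (P Q S : R -> Prop) :
  (forall t, P t -> Q t -> S t) ->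
  {ae (@lebesgue_measure R), forall t, P t} ->
  {ae (@lebesgue_measure R), forall t, Q t} ->
  {ae (@lebesgue_measure R), forall t, S t}.
Proof. by move=> PQS; apply: (@filterS2 _ _ (ae_lebesgue_filter R)). Qed.

(** * Real induction, and functions whose derivative vanishes almost everywhere *)

(** The step passes from any [y] left of [x] to any [z] right of it. Applied at the supremum of the
    good points, it covers both closure under limits and progress beyond them, which is how tagged
    intervals act in Cousin's argument. *)
Lemma real_induction (R : realType) (a b : R) (P : R -> Prop) :
  a <= b -> P a ->
  (forall x, a <= x <= b -> exists2 d : R, 0 < d & forall y z,
     a <= y <= x -> x <= z <= b -> x - y < d -> z - x < d -> P y -> P z) ->
  P b.
Proof.
move=> ab Pa step.
pose E := [set x | a <= x <= b /\ P x].
have Ea : E a by split; rewrite ?lexx.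
have supE : has_sup E.
  by split; [exists a|exists b => x [/andP[_ ->]]].
have asup : a <= sup E by apply: ub_le_sup Ea; exact: supE.2.
have supb : sup E <= b by apply: sup_le_ub => [|x [/andP[]]//]; exists a.
have [|d d0 dP] := step (sup E); first by rewrite asup.
have [y [/andP[ay yb] Py] yd] := sup_adherent d0 supE.
have ys : y <= sup E by apply: ub_le_sup; [exact: supE.2|split=> //; rewrite ay].
(* [z] overshoots the supremum unless [b] stops it, so [z <= sup E] forces [z = b]. *)
pose z := Num.min b (sup E + d / 2).
have zb : z <= b by rewrite ge_min lexx.
have sz : sup E <= z by rewrite le_min supb lerDl divr_ge0// ltW.
have zd : z <= sup E + d / 2 by rewrite ge_min lexx orbT.
have Pz : P z.
  by apply: (dP y) => //; [rewrite ay ys|rewrite sz zb|lra|lra].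
have zs : z <= sup E.
  apply: ub_le_sup; first exact: supE.2.
  by split => //; rewrite zb (le_trans asup sz).
suff <- : z = b by [].
by move: zs; rewrite /z; case: (leP b (sup E + d / 2)) => // _ h; exfalso; lra.
Qed.

(** Straddling is what makes the bound linear in [z - y]: the increments from [x] to either side are
    each at most [e] times their length, and these lengths add up to [z - y]. *)
Lemma is_derive0_slope (R : realType) (F : R -> R) (x e : R) :
  is_derive x 1 F 0 -> 0 < e ->
  exists2 d : R, 0 < d & forall y z, y <= x <= z -> x - y < d -> z - x < d ->
    `|F z - F y| <= e * (z - y).
Proof.
move=> [dF F0] e0.
have : h^-1 *: (F (h *: 1 + x) - F x) @[h --> 0^'] --> 'D_1 F x by exact: dF.
rewrite F0 => /cvgrPdist_lt/(_ _ e0).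
rewrite near_withinE => -[d /= d0 dP]; exists d => // y z /andP[yx xz] yd zd.
have key t : `|t - x| < d -> `|F t - F x| <= e * `|t - x|.
  move=> td; have [->|tx] := eqVneq t x; first by rewrite !subrr normr0 mulr0.
  have tx0 : t - x != 0 by rewrite subr_eq0.
  have := dP (t - x); rewrite /= sub0r normrN => /(_ td tx0).
  rewrite sub0r normrN scaler1 subrK normrZ normfV mulrC ltr_pdivrMr ?normr_gt0//.
  exact: ltW.
have -> : F z - F y = (F z - F x) - (F y - F x) by ring.
apply: le_trans (ler_normB _ _) _.
have hz := key z; have hy := key y.
rewrite ger0_norm ?subr_ge0// in hz; rewrite ler0_norm ?subr_le0// in hy.
have -> : z - y = (z - x) + - (y - x) by ring.
rewrite mulrDr lerD//; [exact: hz|apply: hy; by rewrite opprB].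
Qed.

(* Cousin's covering argument: intervals tagged in the null set [E] stay inside
   an open set of small measure, where absolute continuity bounds the variation;
   over the others the slope of [F] is at most [eps]. *)
Lemma abs_cont_derive0 (R : realType) (a b : R) (F : R -> R) :
  a <= b -> abs_cont_on a b F ->
  {ae (@lebesgue_measure R), forall t, a < t < b -> is_derive t 1 F 0} ->
  F b = F a.
Proof.
move=> ab acF aeF.
(* The endpoints join the exceptional set, since the derivative is known in the open interval
   only. *)
have [N [mN N0 EN]] : mu.-negligible
    ([set t | ~ (a < t < b -> is_derive t 1 F 0)] `|` ([set a] `|` [set b])).
  have n1 (x : R) : mu.-negligible [set x].
    by apply/negligibleP; [exact: measurable_set1|exact: lebesgue_measure_set1].
  exact: (negligibleU aeF (negligibleU (n1 a) (n1 b))).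
have NP t : a <= t <= b -> ~ N t -> is_derive t 1 F 0.
  move=> /andP[at_ tb] Nt.
  have h : ~ ([set t | ~ (a < t < b -> is_derive t 1 F 0)] `|`
              ([set a] `|` [set b])) t by move=> /EN.
  apply: contrapT => nd; apply: h; left => /= h2; apply: nd; apply: h2.
  rewrite !lt_neqAle at_ tb !andbT; apply/andP; split; apply/eqP => e;
    apply: Nt; apply: EN; right; [left|right] => //.
apply/eqP; rewrite -subr_eq0 -normr_eq0; apply/eqP/le_anti; rewrite normr_ge0 andbT.
apply/ler_addgt0Pl => e e0; rewrite addr0.
(* With this slope the regular tags contribute at most [e / 2] over the whole interval; the [+ 1]
   keeps the divisor positive when [a = b]. *)
pose e1 := e / 2 / (b - a + 1).
have ba1 : 0 < b - a + 1 by lra.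
have e10 : 0 < e1 by rewrite !divr_gt0.
have e20 : 0 < e / 2 by rewrite divr_gt0.
have [del del0 delP] := acF (e / 2) e20.
have [U [oU NU muU]] : exists U : set R,
    [/\ open U, N `<=` U & (mu (U `\` N) < del%:E)%E].
  by apply: lebesgue_regularity_outer => //; rewrite [ltLHS](_ : _ = 0%E).
have mU : measurable U by exact: open_measurable.
have muU' : (mu U < del%:E)%E.
  rewrite (_ : U = N `|` (U `\` N)); last by rewrite setDUK.
  apply: le_lt_trans muU.
  rewrite -[leRHS]add0e -[X in (_ <= X + _)%E]N0; apply: measureU2 => //.
  exact: measurableD.
(* Invariant of the sweep up to [x]: the intervals collected around bad tags are in order, their
   total length is paid for by the measure of [U], and the increment of [F] splits into a slope part
   and the increments over these intervals. Families indexed by [nat] can be extended by one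
   interval without casts. *)
pose P x := exists n (l r : nat -> R),
  [/\ forall k, (k < n)%N -> a <= l k /\ l k <= r k /\ r k <= x,
      forall k k', (k < k' < n)%N -> r k <= l k',
      ((\sum_(k < n) (r k - l k))%:E <= mu (U `&` `]a, x]))%E &
      `|F x - F a| <= e1 * (x - a) + \sum_(k < n) `|F (r k) - F (l k)| ].
have : P b.
  apply: (@real_induction _ a b) => //.
    exists 0%N, (fun=> a), (fun=> a); split => //.
    - by rewrite big_ord0; exact: measure_ge0.
    - by rewrite big_ord0 !subrr normr0 mulr0 addr0.
  move=> x axb; have [Nx|Nx] := pselect (N x); last first.
    have [d d0 dP] := is_derive0_slope (NP x axb Nx) e10.
    exists d => // y z /andP[ay yx] /andP[xz zb] yd zd [n [l [r [H1 H2 H3 H4]]]].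
    exists n, l, r; split => //.
    - move=> k kn; have [? [? ?]] := H1 _ kn; do 2 split => //.
      by rewrite (le_trans _ (le_trans yx xz)).
    - apply: (le_trans H3); apply: le_measure; rewrite ?inE.
      + exact: measurableI.
      + exact: measurableI.
      + apply: setIS; apply: subset_itvl; rewrite bnd_simp; exact: le_trans xz.
    - have := dP y z; rewrite yx xz => /(_ isT yd zd) h.
      have -> : F z - F a = (F z - F y) + (F y - F a) by ring.
      apply: le_trans (ler_normD _ _) _.
      have -> : e1 * (z - a) = e1 * (z - y) + e1 * (y - a) by ring.
      by rewrite -addrA lerD.
  (* Bad tag: a whole ball around [x] lies in [U], so the interval from [y] to [z] is appended at
     index [n] and charged to the measure of []y, z]]. *)
  have : nbhs x U by apply: open_nbhs_nbhs; split => //; exact: NU.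
  rewrite -nbhs_ballE => -[d /= d0 dU].
  exists d => // y z /andP[ay yx] /andP[xz zb] yd zd [n [l [r [H1 H2 H3 H4]]]].
  have yz := le_trans yx xz.
  have yzU : `]y, z] `<=` U.
    move=> t /=; rewrite in_itv /= => /andP[yt tz]; apply: dU.
    by rewrite /ball /= ltr_norml; apply/andP; split; lra.
  exists n.+1, (fun k => if (k < n)%N then l k else y),
               (fun k => if (k < n)%N then r k else z); split => //.
  - move=> k kn; case: ifPn => kn'; last by rewrite ay yz.
    by have [? [? ?]] := H1 _ kn'; do 2 split => //; exact: le_trans yz.
  - move=> k k' /andP[kk' kn]; have kn2 : (k < n)%N by exact: leq_trans kk' _.
    rewrite kn2; case: ifPn => k'n; first by apply: H2; rewrite kk'.
    by have [_ []] := H1 _ kn2.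
  - rewrite big_ord_recr /= ltnn.
    under eq_bigr do rewrite ltn_ord.
    rewrite EFinD.
    have -> : U `&` `]a, z] = (U `&` `]a, y]) `|` (U `&` `]y, z]).
      by rewrite -setIUr -itv_bndbnd_setU// bnd_simp.
    rewrite measureU//; [|exact: measurableI|exact: measurableI|]; last first.
      rewrite setIACA setIid; apply/seteqP; split => // t [_ /=] [].
      by rewrite !in_itv /= => /andP[_ ty] /andP[yt _]; move: yt; rewrite ltNge ty.
    apply: leeD => //; rewrite (setIidr yzU).
    rewrite [leRHS](_ : _ = mu (`]y, z] : set R))// lebesgue_measure_itv /= lte_fin.
    by case: ltP => // zy; rewrite lee_fin subr_le0.
  - rewrite big_ord_recr /= ltnn.
    under eq_bigr do rewrite ltn_ord.
    have -> : F z - F a = (F z - F y) + (F y - F a) by ring.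
    apply: le_trans (ler_normD _ _) _.
    have : e1 * (y - a) <= e1 * (z - a) by rewrite ler_pM2l//; lra.
    lra.
move=> [n [l [r [H1 H2 H3 H4]]]].
have H5 : \sum_(k < n) `|F (r k) - F (l k)| < e / 2.
  apply: (delP n (fun k => l k) (fun k => r k)).
  - by move=> k; apply: H1.
  - move=> k k' kk'; have : (k < k')%N || (k' < k)%N.
      by rewrite -neq_ltn; apply: contra kk' => /eqP/val_inj->.
    case/orP => h; [left|right]; apply: H2; by rewrite h ltn_ord.
  - rewrite -lte_fin; apply: (le_lt_trans H3); apply: le_lt_trans muU'.
    apply: le_measure; rewrite ?inE//; exact: measurableI.
have h6 : e1 * (b - a) <= e / 2.
  rewrite /e1 mulrAC ler_pdivrMr// ler_pM2l; lra.
by lra.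
Qed.

(** * The calculus of absolutely continuous functions *)

Lemma abs_cont_onS (R : realType) (a b c d : R) (f : R -> R) :
  a <= c -> d <= b -> abs_cont_on a b f -> abs_cont_on c d f.
Proof.
move=> ac db acf e e0; have [del del0 delP] := acf e e0.
exists del => // N l r H1; apply: delP => k; have [cl [lr rd]] := H1 k.
by split; [exact: le_trans cl|split => //; exact: le_trans db].
Qed.

Lemma abs_cont_onD (R : realType) (a b : R) (f g : R -> R) :
  abs_cont_on a b f -> abs_cont_on a b g ->
  abs_cont_on a b (fun t => f t + g t).
Proof.
move=> acf acg e e0; have e20 : 0 < e / 2 by rewrite divr_gt0.
have [d1 d10 d1P] := acf _ e20; have [d2 d20 d2P] := acg _ e20.
exists (Num.min d1 d2); first by rewrite lt_min d10.
move=> N l r H1 H2; rewrite lt_min => /andP[s1 s2].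
rewrite [ltRHS](splitr e).
apply: le_lt_trans (ltrD (d1P N l r H1 H2 s1) (d2P N l r H1 H2 s2)).
rewrite -big_split /=; apply: ler_sum => k _.
by rewrite opprD addrACA ler_normD.
Qed.

(** The modulus for 1 gives a length below which [f] moves by less than 1, so each step of real
    induction raises the bound by 1. *)
Lemma abs_cont_on_bounded (R : realType) (a b : R) (f : R -> R) :
  a <= b -> abs_cont_on a b f ->
  exists2 M : R, 0 < M & forall t, a <= t <= b -> `|f t| <= M.
Proof.
move=> ab acf; have [d d0 dP] := acf 1 ltr01.
pose P x := exists2 M : R, 0 < M & forall t, a <= t <= x -> `|f t| <= M.
apply: (@real_induction _ a b P) => //.
  exists (1 + `|f a|); first by rewrite ltr_pwDl.
  by move=> t /le_anti <-; rewrite lerDr.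
move=> x _; exists (d / 2); first by rewrite divr_gt0.
move=> y z /andP[ay yx] /andP[xz zb] yd zd [M M0 MP].
exists (M + 1); first by rewrite addr_gt0.
move=> t /andP[at_ tz]; have [ty|yt] := leP t y.
  by rewrite (le_trans (MP t _)) ?at_// lerDl.
have -> : f t = f y + (f t - f y) by ring.
apply: le_trans (ler_normD _ _) _; apply: lerD; first by apply: MP; rewrite ay lexx.
have := dP 1%N (fun=> y) (fun=> t); rewrite !big_ord1 => h.
apply/ltW/h => //.
- by move=> _; rewrite ay (ltW yt) (le_trans tz).
- by move=> k k'; rewrite !ord1 eqxx.
- by clear -tz yd zd; lra.
Qed.

Lemma abs_cont_onM (R : realType) (a b : R) (f g : R -> R) :
  a <= b -> abs_cont_on a b f -> abs_cont_on a b g ->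
  abs_cont_on a b (fun t => f t * g t).
Proof.
move=> ab acf acg e e0; have e20 : 0 < e / 2 by rewrite divr_gt0.
have [Mf Mf0 MfP] := abs_cont_on_bounded ab acf.
have [Mg Mg0 MgP] := abs_cont_on_bounded ab acg.
have [d1 d10 d1P] := acf (e / 2 / Mg) (divr_gt0 e20 Mg0).
have [d2 d20 d2P] := acg (e / 2 / Mf) (divr_gt0 e20 Mf0).
exists (Num.min d1 d2); first by rewrite lt_min d10.
move=> N l r H1 H2; rewrite lt_min => /andP[s1 s2].
have h1 := d1P N l r H1 H2 s1; have h2 := d2P N l r H1 H2 s2.
rewrite ltr_pdivlMr// mulr_suml in h1; rewrite ltr_pdivlMr// mulr_suml in h2.
rewrite [ltRHS](splitr e).
apply: le_lt_trans (ltrD h1 h2); rewrite -big_split /=; apply: ler_sum => k _.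
have [al [lr rb]] := H1 k.
have -> : f (r k) * g (r k) - f (l k) * g (l k) =
  (f (r k) - f (l k)) * g (r k) + (g (r k) - g (l k)) * f (l k) by ring.
apply: le_trans (ler_normD _ _) _; rewrite !normrM.
apply: lerD; apply: ler_wpM2l => //; [apply: MgP|apply: MfP].
  by rewrite rb (le_trans al).
by rewrite al (le_trans lr).
Qed.

(** The concrete functions of the proof get their absolute continuity from a Lipschitz bound, which
    follows from a bounded derivative and is easier to join across nodes than the epsilon-delta
    condition. *)
Definition lipschitz_in (R : realType) (a b : R) (f : R -> R) :=
  exists2 K : R, 0 < K &
    forall s t, a <= s -> s <= t -> t <= b -> `|f t - f s| <= K * (t - s).

Lemma lipschitz_in_abs_cont (R : realType) (a b : R) (f : R -> R) :
  lipschitz_in a b f -> abs_cont_on a b f.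
Proof.
move=> [K K0 KP] e e0; exists (e / K); first by rewrite divr_gt0.
move=> N l r H1 _; rewrite ltr_pdivlMr// mulrC; apply: le_lt_trans.
by rewrite mulr_sumr; apply: ler_sum => k _; have [? [? ?]] := H1 k; exact: KP.
Qed.

Lemma abs_cont_on_cst (R : realType) (a b c : R) : abs_cont_on a b (fun=> c).
Proof.
apply: lipschitz_in_abs_cont; exists 1 => // s t _ st _.
by rewrite subrr normr0 mul1r subr_ge0.
Qed.

Lemma abs_cont_onB (R : realType) (a b : R) (f g : R -> R) :
  a <= b -> abs_cont_on a b f -> abs_cont_on a b g ->
  abs_cont_on a b (fun t => f t - g t).
Proof.
move=> ab acf acg; rewrite (_ : (fun _ => _) = fun t => f t + -1 * g t).
  by apply: abs_cont_onD => //; apply: abs_cont_onM => //; exact: abs_cont_on_cst.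
by apply/funext => t; rewrite mulN1r.
Qed.

Lemma abs_cont_on_sum (R : realType) (a b : R) (n : nat) (f : 'I_n -> R -> R) :
  (forall i, abs_cont_on a b (f i)) ->
  abs_cont_on a b (fun t => \sum_(i < n) f i t).
Proof.
elim: n f => [|n ih] f acf.
  rewrite (_ : (fun _ => _) = fun=> 0); first exact: abs_cont_on_cst.
  by apply/funext => t; rewrite big_ord0.
rewrite (_ : (fun _ => _) =
  fun t => \sum_(i < n) f (widen_ord (leqnSn n) i) t + f ord_max t).
  by apply: abs_cont_onD => //; apply: ih.
by apply/funext => t; rewrite big_ord_recr.
Qed.

(** The increments are at most the integral of [|h|] over the union of the intervals, and that
    integral is small once the union has small measure. *)
Lemma abs_cont_on_integral (R : realType) (a b : R) (h : R -> R) :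
  mu.-integrable setT (EFin \o h) ->
  abs_cont_on a b (fun t => Rintegral mu `[a, t] h).
Proof.
move=> ih e e0; have [d [d0 dP]] := integral_normr_continuous ih e0.
exists d => // N l r H1 H2 Hd.
have ihA (A : set R) : measurable A -> mu.-integrable A (EFin \o h).
  by move=> mA; apply: integrableS ih.
have inh (A : set R) : measurable A -> mu.-integrable A (EFin \o (fun x => `|h x|)).
  by move=> mA; have := integrable_abse (ihA A mA).
(* Left-open intervals stay disjoint even when two of them share an endpoint. *)
pose I k : set R := `]l k, r k]%classic.
pose D := \big[setU/set0]_(k <- index_enum 'I_N) I k.
have mD : measurable D by apply: bigsetU_measurable => k _; exact: measurable_itv.
have tI : trivIset [set` index_enum 'I_N] I.
  apply/trivIsetP => i j _ _ ij; apply/seteqP; split => // t [] /=.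
  rewrite /I /= !in_itv /= => /andP[lit tri] /andP[ljt trj].
  by case: (H2 _ _ ij) => h'; exfalso; lra.
have muD : (mu D < d%:E)%E.
  apply: le_lt_trans (_ : (_ <= (\sum_(k < N) (r k - l k))%:E)%E) _; last by rewrite lte_fin.
  have [_ muDs] : measurable D /\ (mu D <= \sum_(k < N) mu (I k))%E.
    rewrite /D; elim/big_rec2: _ => [|k A s _ [ms As]].
      by split; [exact: measurable0|rewrite measure0].
    have mI : measurable (I k) by exact: measurable_itv.
    split; first exact: measurableU.
    apply: (@le_trans _ _ (mu (I k) + mu s)%E); last exact: leeD2l.
    exact: measureU2.
  apply: (le_trans muDs); rewrite -sumEFin.
  apply: lee_sum => k _; rewrite [leLHS](_ : _ = mu (`]l k, r k] : set R))//.
  rewrite lebesgue_measure_itv /= lte_fin; case: ltP => // h'.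
  by rewrite lee_fin subr_ge0; have [_ []] := H1 k.
apply: le_lt_trans (dP D mD muD).
rewrite /Rintegral integral_bigsetU_EFin//=; last first.
- by apply: measurable_int; exact: inh.
- exact: index_enum_uniq.
- by move=> i; exact: measurable_itv.
have -> : (\sum_(k < N) \int[mu]_(x in I k) `|h x|%:E)%E =
          (\sum_(k < N) fine (\int[mu]_(x in I k) `|h x|%:E))%:E.
  rewrite -sumEFin; apply: eq_bigr => k _; rewrite fineK//.
  by apply: integrable_fin_num => //; [exact: measurable_itv|exact: inh (measurable_itv _)].
apply: ler_sum => k _; have [al [lr rb]] := H1 k.
rewrite -/(Rintegral _ _ _) -/(Rintegral _ _ _) Rintegral_itvB//; last first.
  by apply: ihA; exact: measurable_itv.
by apply: le_normr_Rintegral => //; apply: ihA; exact: measurable_itv.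
Qed.

(** By Lebesgue differentiation, [f] minus the indefinite integral of [g] has zero derivative almost
    everywhere, hence is constant. Extending [g] by 0 makes it integrable on the whole line. *)
Lemma abs_cont_FTC (R : realType) (a b : R) (f g : R -> R) :
  a <= b -> abs_cont_on a b f -> mu.-integrable `[a, b] (EFin \o g) ->
  {ae (@lebesgue_measure R), forall t, a < t < b -> is_derive t 1 f (g t)} ->
  Rintegral mu `[a, b] g = f b - f a.
Proof.
move=> ab acf ig aef; pose h := g \_ `[a, b].
have ih : mu.-integrable setT (EFin \o h).
  by rewrite /h -restrict_EFin; apply/integrable_restrict => //=; rewrite setTI.
have hg t : a <= t <= b -> h t = g t.
  by move=> tab; rewrite /h patchE mem_set //= in_itv.
pose G t := Rintegral mu `[a, t] h.
have aelp : {ae (@lebesgue_measure R), forall t, lebesgue_pt h t}.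
  apply: lebesgue_differentiation.
  exact: integrable_locally (measurable_itv _) ig.
have : f b - G b = f a - G a.
  apply: (@abs_cont_derive0 _ a b (fun t => f t - G t)) => //.
    by apply: abs_cont_onB => //; exact: abs_cont_on_integral.
  apply: ae_lebesgue2 aef aelp => t ft lt_ /andP[at_ tb].
  have [dG G'] : derivable G t 1 /\ derive1 G t = h t.
    apply: (@FTC1_lebesgue_pt _ h (BLeft a) t b) => //.
    exact: integrableS ih.
  have Gd : is_derive t 1 G (h t) by split => //; rewrite -derive1E.
  have fd := ft; rewrite at_ tb in fd; have {}fd := fd isT.
  have -> : (0 : R) = g t - h t by rewrite hg ?subrr// !ltW.
  exact: is_deriveB.
have -> : G a = 0 by rewrite /G set_itv1 Rintegral_set1.
have -> : G b = Rintegral mu `[a, b] g.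
  by apply: eq_Rintegral => t; rewrite inE /= in_itv => /hg.
lra.
Qed.

(** * Continuity and derivatives of matrix functions *)

Local Notation cont_on a b f := {within `[a, b], continuous f}.

Section continuous_entries.
Variables (R : realType) (a b : R).

Lemma cont_on_ext (f g : R -> R) :
  (forall t, a <= t <= b -> f t = g t) -> cont_on a b f -> cont_on a b g.
Proof.
move=> fg; apply: subspace_eq_continuous => t; rewrite inE /= in_itv /=.
exact: fg.
Qed.

Lemma cont_on_cst (c : R) : cont_on a b (fun=> c).
Proof. by move=> t; exact: cvg_cst. Qed.

Lemma cont_onD (f g : R -> R) :
  cont_on a b f -> cont_on a b g -> cont_on a b (fun t => f t + g t).
Proof. by move=> cf cg t; apply: cvgD; [exact: cf|exact: cg]. Qed.

Lemma cont_onM (f g : R -> R) :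
  cont_on a b f -> cont_on a b g -> cont_on a b (fun t => f t * g t).
Proof. by move=> cf cg t; apply: cvgM; [exact: cf|exact: cg]. Qed.

Lemma cont_onS (c d : R) (f : R -> R) :
  a <= c -> d <= b -> cont_on a b f -> cont_on c d f.
Proof.
move=> ac db; apply: continuous_subspaceW; apply: subset_itv.
  by rewrite bnd_simp.
by rewrite bnd_simp.
Qed.

Lemma cont_on_sum (I : Type) (r : seq I) (f : I -> R -> R) :
  (forall i, cont_on a b (f i)) -> cont_on a b (fun t => \sum_(i <- r) f i t).
Proof.
move=> cf; elim: r => [|i r ih].
  rewrite (_ : (fun _ => _) = fun=> 0); first exact: cont_on_cst.
  by apply/funext => t; rewrite big_nil.
rewrite (_ : (fun _ => _) = fun t => f i t + \sum_(j <- r) f j t).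
  exact: cont_onD.
by apply/funext => t; rewrite big_cons.
Qed.

Lemma cont_on_prod (I : Type) (r : seq I) (f : I -> R -> R) :
  (forall i, cont_on a b (f i)) -> cont_on a b (fun t => \prod_(i <- r) f i t).
Proof.
move=> cf; elim: r => [|i r ih].
  rewrite (_ : (fun _ => _) = fun=> 1); first exact: cont_on_cst.
  by apply/funext => t; rewrite big_nil.
rewrite (_ : (fun _ => _) = fun t => f i t * \prod_(j <- r) f j t).
  exact: cont_onM.
by apply/funext => t; rewrite big_cons.
Qed.

Lemma cont_on_bounded (f : R -> R) : a <= b -> cont_on a b f ->
  exists2 K : R, 0 < K & forall t, a <= t <= b -> `|f t| <= K.
Proof.
move=> ab cf.
have [c _ cP] := EVT_max ab cf; have [d _ dP] := EVT_min ab cf.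
exists (`|f c| + `|f d| + 1); first by rewrite ltr_wpDl// addr_ge0.
move=> t tab; have {cP} := cP t; have {dP} := dP t; rewrite !in_itv /=.
move=> /(_ tab) dt /(_ tab) tc; rewrite ler_norml; apply/andP; split.
  have : - `|f d| <= f d by rewrite lerNl -normrN ler_norm.
  by have := normr_ge0 (f c); lra.
by have := ler_norm (f c); have := normr_ge0 (f d); lra.
Qed.

Definition mx_cont_on (m n : nat) (F : R -> 'M[R]_(m, n)) :=
  forall i j, cont_on a b (fun t => F t i j).

Lemma mx_cont_on_mul (m n p : nat) (F : R -> 'M[R]_(m, n)) (G : R -> 'M[R]_(n, p)) :
  mx_cont_on F -> mx_cont_on G -> mx_cont_on (fun t => F t *m G t).
Proof.
move=> cF cG i j.
rewrite (_ : (fun _ => _) = fun t => \sum_k F t i k * G t k j).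
  by apply: cont_on_sum => k; exact: cont_onM.
by apply/funext => t; rewrite mxE.
Qed.

Lemma mx_cont_on_tr (m n : nat) (F : R -> 'M[R]_(m, n)) :
  mx_cont_on F -> mx_cont_on (fun t => (F t)^T).
Proof.
move=> cF i j; rewrite (_ : (fun _ => _) = fun t => F t j i); first exact: cF.
by apply/funext => t; rewrite mxE.
Qed.

Lemma mx_cont_on_cst (m n : nat) (C : 'M[R]_(m, n)) : mx_cont_on (fun=> C).
Proof. by move=> i j; exact: cont_on_cst. Qed.

Lemma mx_cont_on_ext (m n : nat) (F G : R -> 'M[R]_(m, n)) :
  (forall t, a <= t <= b -> F t = G t) -> mx_cont_on F -> mx_cont_on G.
Proof.
move=> FG cF i j; apply: (@cont_on_ext (fun t => F t i j)); last exact: cF.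
by move=> t /FG ->.
Qed.

Lemma cont_on_det (n : nat) (F : R -> 'M[R]_n) :
  mx_cont_on F -> cont_on a b (fun t => \det (F t)).
Proof.
move=> cF; apply: cont_on_sum => s; apply: cont_onM; first exact: cont_on_cst.
by apply: cont_on_prod => i; exact: cF.
Qed.

(** By Cramer's rule the entries are cofactors, polynomial in those of [F], divided by a determinant
    that never vanishes on the interval. *)
Lemma mx_cont_on_inv (n : nat) (F : R -> 'M[R]_n) :
  mx_cont_on F -> (forall t, a <= t <= b -> F t \in unitmx) ->
  mx_cont_on (fun t => invmx (F t)).
Proof.
move=> cF uF; pose H t := (\det (F t))^-1 *: \adj (F t).
apply: (@mx_cont_on_ext _ _ H) => [t /uF u|].
  by rewrite /H /invmx u.
move=> i j; rewrite (_ : (fun _ => _) =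
  fun t => (\det (F t))^-1 * ((-1) ^+ (j + i) * \det (row' j (col' i (F t))))).
  apply: cont_onM.
    apply: (@within_continuous_comp _ _ _ `[a, b]%classic _ (@GRing.inv R)).
      move=> _ /[!inE] -[t tab <-]; apply: inv_continuous.
      by rewrite -unitfE -unitmxE uF//; move: tab; rewrite /= in_itv.
    exact: cont_on_det.
  apply: cont_onM; first exact: cont_on_cst.
  apply: cont_on_det => k l.
  rewrite (_ : (fun _ => _) = fun t => F t (lift j k) (lift i l)); first exact: cF.
  by apply/funext => t; rewrite !mxE.
by apply/funext => t; rewrite !mxE.
Qed.
End continuous_entries.

Section matrix_derivative.
Variable R : realType.

Lemma is_derive_bigsum (n : nat) (f : 'I_n -> R -> R) (d : 'I_n -> R) (t : R) :
  (forall i, is_derive t 1 (f i) (d i)) ->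
  is_derive t 1 (fun s => \sum_(i < n) f i s) (\sum_(i < n) d i).
Proof.
move=> fd; rewrite (_ : (fun _ => _) = \sum_(i < n) f i).
  exact: is_derive_sum.
by apply/funext => s; rewrite fct_sumE.
Qed.

Definition mx_is_derive (m n : nat) (t : R) (F : R -> 'M[R]_(m, n)) (D : 'M[R]_(m, n)) :=
  forall i j, is_derive t 1 (fun s => F s i j) (D i j).

Lemma mx_is_derive_mul (m n p : nat) (t : R) (F : R -> 'M[R]_(m, n))
    (G : R -> 'M[R]_(n, p)) (DF : 'M[R]_(m, n)) (DG : 'M[R]_(n, p)) :
  mx_is_derive t F DF -> mx_is_derive t G DG ->
  mx_is_derive t (fun s => F s *m G s) (DF *m G t + F t *m DG).
Proof.
move=> dF dG i j.
rewrite (_ : (fun _ => _) = fun s => \sum_k F s i k * G s k j); last first.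
  by apply/funext => s; rewrite mxE.
rewrite !mxE -big_split /=; apply: is_derive_bigsum => k.
rewrite [X in is_derive _ _ _ X](_ : _ = F t i k *: DG k j + G t k j *: DF i k).
  exact: is_deriveM.
by rewrite /GRing.scale /= addrC [G t k j * _]mulrC.
Qed.

Lemma mx_is_deriveD (m n : nat) (t : R) (F G : R -> 'M[R]_(m, n))
    (DF DG : 'M[R]_(m, n)) :
  mx_is_derive t F DF -> mx_is_derive t G DG ->
  mx_is_derive t (fun s => F s + G s) (DF + DG).
Proof.
move=> dF dG i j; rewrite mxE.
rewrite (_ : (fun _ => _) = (fun s => F s i j) + (fun s => G s i j)).
  exact: is_deriveD.
by apply/funext => s; rewrite mxE.
Qed.

Lemma mx_is_deriveN (m n : nat) (t : R) (F : R -> 'M[R]_(m, n)) (D : 'M[R]_(m, n)) :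
  mx_is_derive t F D -> mx_is_derive t (fun s => - F s) (- D).
Proof.
move=> dF i j; rewrite mxE.
rewrite (_ : (fun _ => _) = - (fun s => F s i j)); first exact: is_deriveN.
by apply/funext => s; rewrite mxE.
Qed.

Lemma mx_is_derive_cst (m n : nat) (t : R) (C : 'M[R]_(m, n)) :
  mx_is_derive t (fun=> C) 0.
Proof. by move=> i j; rewrite mxE; exact: is_derive_cst. Qed.

Lemma cvg_bigsum (T : Type) (F : set_system T) (FF : Filter F) (n : nat)
    (f : 'I_n -> T -> R) (l : 'I_n -> R) :
  (forall i, f i x @[x --> F] --> l i) ->
  \sum_(i < n) f i x @[x --> F] --> \sum_(i < n) l i.
Proof.
elim: n f l => [|n ih] f l fl.
  rewrite (_ : (fun _ => _) = fun=> 0); first by rewrite big_ord0; exact: cvg_cst.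
  by apply/funext => t; rewrite big_ord0.
rewrite (_ : (fun _ => _) =
  fun t => \sum_(i < n) f (widen_ord (leqnSn n) i) t + f ord_max t).
  by rewrite big_ord_recr /=; apply: cvgD; [apply: ih|].
by apply/funext => t; rewrite big_ord_recr.
Qed.

(** The identity G(t+h) - G(t) = - G(t+h) (F(t+h) - F(t)) G(t) turns the difference quotient of [G]
    into that of [F], so continuity of [G] is enough to pass to the limit. *)
Lemma mx_is_derive_inv (n : nat) (t : R) (F G : R -> 'M[R]_n) (D : 'M[R]_n) :
  mx_is_derive t F D ->
  (\near t, G t *m F t = 1%:M) -> F t *m G t = 1%:M ->
  (forall i j, {for t, continuous (fun s => G s i j)}) ->
  mx_is_derive t G (- (G t *m D *m G t)).
Proof.
move=> dF GF FG cG i j.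
suff : h^-1 *: (G (h *: 1 + t) i j - G t i j) @[h --> 0^'] -->
    (- (G t *m D *m G t)) i j.
  move=> h; split; first exact: cvgP h.
  exact: cvg_lim h.
have shift : h *: 1 + t @[h --> 0^'] --> t.
  rewrite -[X in _ --> X]add0r -[X in _ --> X + _](scale0r (1 : R)).
  apply: cvgD; last exact: cvg_cst.
  apply: cvgZr_tmp; exact: nbhs_dnbhs.
rewrite !mxE.
pose q h k l := h^-1 *: (F (h *: 1 + t) k l - F t k l).
have lim : - \sum_l (\sum_k G (h *: 1 + t) i k * q h k l) * G t l j @[h --> 0^'] -->
    - \sum_l (G t *m D) i l * G t l j.
  apply: cvgN; apply: cvg_bigsum => l; apply: cvgM; last exact: cvg_cst.
  rewrite mxE; apply: cvg_bigsum => k; apply: cvgM.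
    exact: (cvg_comp _ _ shift (cG i k)).
  have [dFkl <-] := dF k l; exact: dFkl.
apply: cvg_trans lim; apply: near_eq_cvg.
have : \forall h \near 0^', G (h *: 1 + t) *m F (h *: 1 + t) = 1%:M by exact: (shift _ GF).
apply: filterS => h GFh.
transitivity ((- (G (h *: 1 + t) *m (h^-1 *: (F (h *: 1 + t) - F t)) *m G t)) i j).
  rewrite !mxE; congr (- _); apply: eq_bigr => l _; rewrite mxE; congr (_ * _).
  by apply: eq_bigr => k _; rewrite !mxE.
rewrite -scalemxAr -scalemxAl mulmxBr mulmxBl GFh mul1mx -mulmxA FG mulmx1.
by rewrite !mxE -mulrN opprB.
Qed.
End matrix_derivative.

(** * Linear differential equations and the transition matrix *)

Section linear_ode.
Variables (R : realType) (a b : R).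

Lemma bounded_derive_lipschitz (f g : R -> R) :
  cont_on a b f -> cont_on a b g ->
  (forall t, a < t < b -> is_derive t 1 f (g t)) -> lipschitz_in a b f.
Proof.
move=> cf cg fg; have [ab|ba] := leP a b; last first.
  by exists 1 => // s t as_ st tb; exfalso; lra.
have [K K0 KP] := cont_on_bounded ab cg.
exists K => // s t as_ st tb.
have [|x|c] := @MVT_segment _ f g s t st.
- move=> x; rewrite in_itv /= => /andP[sx xt]; apply: fg.
  by rewrite (le_lt_trans as_ sx) (lt_le_trans xt tb).
- by apply: (cont_onS _ _ cf).
rewrite in_itv /= => /andP[sc ct] ->.
rewrite normrM [`|t - s|]ger0_norm ?subr_ge0// ler_wpM2r ?subr_ge0// KP//.
by rewrite (le_trans as_ sc) (le_trans ct tb).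
Qed.

(** The bound makes exp(-K t) E nonincreasing and exp(K t) E nondecreasing. Since [E] is nonnegative
    and vanishes at [s], the former gives 0 to the right of [s] and the latter to the left. Both
    directions count, as the base point of a transition matrix may lie anywhere in the interval. *)
Lemma gronwall0 (E dE : R -> R) (K s : R) :
  cont_on a b E -> (forall t, a < t < b -> is_derive t 1 E (dE t)) ->
  (forall t, a < t < b -> `|dE t| <= K * E t) ->
  (forall t, 0 <= E t) -> a <= s <= b -> E s = 0 ->
  forall t, a <= t <= b -> E t = 0.
Proof.
move=> cE dEP dEK E0 /andP[as_ sb] Es t /andP[at_ tb].
have de (c u : R) : is_derive u 1 (fun u : R => expR (c * u)) (c * expR (c * u)).
  have d1 : is_derive u 1 (fun u : R => c * u) c.
    rewrite [X in is_derive _ _ _ X](_ : _ = c *: (1 : R)); last by rewrite /GRing.scale /= mulr1.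
    exact: is_deriveZ.
  rewrite mulrC.
  exact: (@is_derive1_comp _ expR (fun u => c * u) u _ _ (is_derive_expR _) d1).
have ce (c : R) : cont_on a b (fun u : R => expR (c * u)).
  by apply: derivable_within_continuous => x _; have [] := de c x.
have main c : c = - K \/ c = K -> forall u, a < u < b ->
  is_derive u 1 (fun u => expR (c * u) * E u) (expR (c * u) * (dE u + c * E u)).
  move=> _ u uab.
  rewrite [X in is_derive _ _ _ X](_ : _ =
    expR (c * u) *: dE u + E u *: (c * expR (c * u))).
    exact: (is_deriveM (de c u) (dEP u uab)).
  by rewrite /GRing.scale /=; ring.
have E1 : E t <= 0.
  have [ts|/ltW st] := leP t s.
    have := @ler0_derive1_nincr _ (fun u => - (expR (K * u) * E u)) a b _ _ _ t s at_ ts sb.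
    rewrite Es mulr0 lerN2 => h.
    rewrite -(pmulr_rle0 _ (expR_gt0 (K * t))); apply: h.
    - move=> u; rewrite in_itv /= => uab; by have [] := is_deriveN (main K (or_intror erefl) u uab).
    - move=> u; rewrite in_itv /= => uab; rewrite derive1E.
      have d1 := is_deriveN (main K (or_intror erefl) u uab).
      rewrite (@derive_val _ _ _ _ _ _ _ d1) oppr_le0 mulr_ge0 ?expR_ge0//.
      by have := dEK u uab; rewrite ler_norml => /andP[h1 _]; lra.
    - move=> x; apply: cvgN; exact: (cont_onM (ce K) cE).
  have := @ler0_derive1_nincr _ (fun u => expR (- K * u) * E u) a b _ _ _ s t as_ st tb.
  rewrite Es mulr0 => h.
  rewrite -(pmulr_rle0 _ (expR_gt0 (- K * t))); apply: h.
  - move=> u; rewrite in_itv /= => uab; by have [] := main (- K) (or_introl erefl) u uab.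
  - move=> u; rewrite in_itv /= => uab; rewrite derive1E.
    have d1 := main (- K) (or_introl erefl) u uab.
    rewrite (@derive_val _ _ _ _ _ _ _ d1) mulr_ge0_le0 ?expR_ge0//.
    by have := dEK u uab; rewrite ler_norml => /andP[_ h1]; lra.
  - exact: (cont_onM (ce (- K)) cE).
by apply/le_anti; rewrite E1 E0.
Qed.

Lemma linear_ode_eq0 (n : nat) (A : R -> 'M[R]_n) (x : R -> 'cV[R]_n) (s : R) :
  mx_cont_on a b A -> mx_cont_on a b x ->
  (forall t, a < t < b -> mx_is_derive t x (A t *m x t)) ->
  a <= s <= b -> x s = 0 -> forall t, a <= t <= b -> x t = 0.
Proof.
move=> cA cx dx sab xs0.
have ab : a <= b by case/andP: sab; exact: le_trans.
have {cA} [M M0 MP] : exists2 M : R, 0 <= M &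
    forall t i j, a <= t <= b -> `|A t i j| <= M.
  have h i j : exists K : R, 0 < K /\ forall t, a <= t <= b -> `|A t i j| <= K.
    by have [K K0 KP] := cont_on_bounded ab (cA i j); exists K.
  pose Kf i j := sval (cid (h i j)).
  have KfP i j := svalP (cid (h i j)) : 0 < Kf i j /\ forall t, a <= t <= b -> `|A t i j| <= Kf i j.
  exists (\sum_i \sum_j Kf i j).
    by apply: sumr_ge0 => i _; apply: sumr_ge0 => j _; apply: ltW; have [] := KfP i j.
  move=> t i j tab; have [_ /(_ t tab) /le_trans] := KfP i j; apply.
  have Kge i' j' : 0 <= Kf i' j' by apply: ltW; have [] := KfP i' j'.
  rewrite (bigD1 i) //= (bigD1 j) //= -addrA lerDl addr_ge0//.
    by apply: sumr_ge0 => k _.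
  by apply: sumr_ge0 => k _; apply: sumr_ge0 => l _.
pose E t := \sum_(k < n) x t k 0 ^+ 2.
pose dE t := \sum_(k < n) 2 * (x t k 0 * (A t *m x t) k 0).
have E0 t : 0 <= E t by apply: sumr_ge0 => k _; exact: sqr_ge0.
have Ex t : E t = 0 -> x t = 0.
  move=> /eqP; rewrite psumr_eq0 => [/allP h|k _]; last exact: sqr_ge0.
  apply/matrixP => i j; rewrite ord1 mxE; apply/eqP.
  by have := h i (mem_index_enum _); rewrite sqrf_eq0.
(* The derivative of |x|^2 is twice <x, A x>. With entries of [A] bounded by [M] and |x_k x_j| <=
   (x_k^2 + x_j^2) / 2, the double sum is at most n M |x|^2, whence the constant. *)
move=> t tab; apply: Ex; apply: (@gronwall0 E dE (2 * M * n%:R) s) => //.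
- apply: cont_on_sum => k.
  rewrite (_ : (fun _ => _) = fun t => x t k 0 * x t k 0); last first.
    by apply/funext => u; rewrite expr2.
  exact: cont_onM.
- move=> u uab; apply: is_derive_bigsum => k.
  rewrite (_ : (fun _ => _) = (fun t => x t k 0) * (fun t => x t k 0)); last first.
    by apply/funext => v; rewrite expr2.
  rewrite [X in is_derive _ _ _ X](_ : _ =
    x u k 0 *: (A u *m x u) k 0 + x u k 0 *: (A u *m x u) k 0).
    by apply: is_deriveM; exact: dx.
  by rewrite /GRing.scale /= mulr2n; ring.
- move=> u /andP[au ub]; have uab : a <= u <= b by rewrite !ltW.
  rewrite /dE -mulr_sumr normrM ger0_norm// -!mulrA ler_pM2l//.
  apply: le_trans (ler_norm_sum _ _ _) _.
  apply: (@le_trans _ _ (\sum_(k < n) \sum_(j < n)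
      M * ((x u k 0 ^+ 2 + x u j 0 ^+ 2) / 2))).
    apply: ler_sum => k _; rewrite mxE mulr_sumr.
    apply: le_trans (ler_norm_sum _ _ _) _; apply: ler_sum => j _.
    rewrite mulrCA normrM; apply: ler_pM => //; first exact: MP.
    rewrite ler_norml; apply/andP; split.
      by have := sqr_ge0 (x u k 0 + x u j 0); rewrite !expr2; lra.
    by have := sqr_ge0 (x u k 0 - x u j 0); rewrite !expr2; lra.
  under eq_bigr do rewrite -mulr_sumr -mulr_suml big_split /= sumr_const card_ord.
  rewrite -mulr_sumr -mulr_suml big_split /= sumr_const card_ord.
  rewrite -/(E u) sumrMnl -/(E u) ler_wpM2l// -mulr_natl.
  lra.
- by rewrite /E big1// => k _; rewrite xs0 mxE expr0n.
Qed.

Lemma linear_ode_eq0_mx (n p : nat) (A : R -> 'M[R]_n) (X : R -> 'M[R]_(n, p)) (s : R) :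
  mx_cont_on a b A -> mx_cont_on a b X ->
  (forall t, a < t < b -> mx_is_derive t X (A t *m X t)) ->
  a <= s <= b -> X s = 0 -> forall t, a <= t <= b -> X t = 0.
Proof.
move=> cA cX dX sab Xs t tab; apply/matrixP => i j.
have cE u i' : col j (X u) i' 0 = X u i' j by rewrite mxE.
have := @linear_ode_eq0 n A (fun u => col j (X u)) s cA.
move=> /(_ _ _ sab _ t tab) => h.
rewrite -cE h ?mxE//.
- move=> i' j'; rewrite (_ : (fun _ => _) = fun t => X t i' j); first exact: cX.
  by apply/funext => u; rewrite mxE.
- move=> u uab i' j'; rewrite (_ : (fun _ => _) = fun t => X t i' j); last first.
    by apply/funext => v; rewrite mxE.
  rewrite (_ : (A u *m _) i' j' = (A u *m X u) i' j); first exact: dX.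
  by rewrite !mxE; apply: eq_bigr => k _; rewrite mxE.
- by rewrite Xs; apply/matrixP => k l; rewrite !mxE.
Qed.

Variables (n : nat) (A : R -> 'M[R]_n) (Phi : R -> R -> 'M[R]_n).
Hypotheses (cA : mx_cont_on a b A) (TP : transition_matrix A a b Phi).

Lemma transition_cont s : a <= s <= b -> mx_cont_on a b (fun t => Phi t s).
Proof. by move=> sab i j; have [_ /(_ i j)[]] := TP sab. Qed.

Lemma transition_derive s t : a <= s <= b -> a < t < b ->
  mx_is_derive t (fun u => Phi u s) (A t *m Phi t s).
Proof.
move=> sab tab i j; have [_ /(_ i j)[_ /(_ t tab)[d1 d2]]] := TP sab.
by split => //; rewrite -derive1E.
Qed.

Lemma transition_id s : a <= s <= b -> Phi s s = 1%:M.
Proof. by move=> /TP[]. Qed.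

(** As functions of [t] both sides solve the same linear equation, and they agree at [t = r]. *)
Lemma transition_comp t r s : a <= t <= b -> a <= r <= b -> a <= s <= b ->
  Phi t r *m Phi r s = Phi t s.
Proof.
move=> tab rab sab; apply/eqP; rewrite -subr_eq0; apply/eqP.
apply: (@linear_ode_eq0_mx n n A (fun t => Phi t r *m Phi r s - Phi t s) r cA) => //.
- move=> i j; rewrite (_ : (fun _ => _) = fun t => (Phi t r *m Phi r s) i j + -1 * Phi t s i j).
    apply: cont_onD; last by apply: cont_onM; [exact: cont_on_cst|exact: transition_cont].
    apply: mx_cont_on_mul; first exact: transition_cont.
    exact: mx_cont_on_cst.
  by apply/funext => u; rewrite !mxE mulN1r.
- move=> u uab; rewrite mulmxBr mulmxA; apply: mx_is_deriveD.
    rewrite -[_ *m Phi r s]addr0 -(mulmx0 _ (Phi u r)).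
    by apply: mx_is_derive_mul; [exact: transition_derive|exact: mx_is_derive_cst].
  by apply: mx_is_deriveN; exact: transition_derive.
- by rewrite transition_id// mul1mx subrr.
Qed.

Lemma transition_inv t s : a <= t <= b -> a <= s <= b ->
  Phi t s *m Phi s t = 1%:M.
Proof. by move=> tab sab; rewrite transition_comp// transition_id. Qed.

Lemma transition_unit t s : a <= t <= b -> a <= s <= b -> Phi t s \in unitmx.
Proof. by move=> tab sab; case/mulmx1_unit: (transition_inv tab sab). Qed.

(** In its second argument [Phi s] is the inverse of the function [Phi t s] of [t], whose continuity
    is part of [transition_matrix]. *)
Lemma transition_cont2 s : a <= s <= b -> mx_cont_on a b (Phi s).
Proof.
move=> sab; apply: (@mx_cont_on_ext _ _ _ _ _ (fun t => invmx (Phi t s))) => [t tab|].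
  apply: (can_inj (mulmxK (transition_unit tab sab))).
  by rewrite mulVmx ?transition_unit// transition_inv.
by apply: mx_cont_on_inv => [|t tab]; [exact: transition_cont|exact: transition_unit].
Qed.

(** The rule for the inverse yields - Phi(s,t) (A Phi(t,s)) Phi(s,t), where the last two transition
    matrices cancel. Transposed, this is the adjoint equation obeyed by the costates. *)
Lemma transition_derive2 s t : a <= s <= b -> a < t < b ->
  mx_is_derive t (Phi s) (- (Phi s t *m A t)).
Proof.
move=> sab /[dup] tab' /andP[at_ tb]; have tab : a <= t <= b by rewrite !ltW.
have -> : Phi s t *m A t = Phi s t *m (A t *m Phi t s) *m Phi s t.
  by rewrite -!mulmxA transition_inv// mulmx1.
apply: (@mx_is_derive_inv _ _ _ (fun u => Phi u s)).
- exact: transition_derive.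
- have : \forall u \near t, u \in `]a, b[ by exact: near_in_itvoo.
  apply: filterS => u; rewrite in_itv /= => /andP[au ub].
  by rewrite transition_inv// !ltW.
- exact: transition_inv.
- move=> i j; have cP : mx_cont_on a b (Phi s) := transition_cont2 sab.
  have := cP i j.
  have lab : a < b by exact: lt_trans tb.
  move=> /(continuous_within_itvP _ lab)[h _ _]; apply: h.
  by rewrite in_itv /= at_.
Qed.

End linear_ode.

(** * The trajectory on one piece *)

Section matrix_integral.
Variable R : realType.

Lemma cont_on_integrable (a b : R) (f : R -> R) :
  cont_on a b f -> mu.-integrable `[a, b] (EFin \o f).
Proof.
by move=> cf; apply: continuous_compact_integrable => //; exact: segment_compact.
Qed.

Lemma integrable_bigsum (D : set R) (n : nat) (f : 'I_n -> R -> R) :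
  measurable D -> (forall i, mu.-integrable D (EFin \o f i)) ->
  mu.-integrable D (EFin \o (fun t => \sum_(i < n) f i t)).
Proof.
move=> mD fi; rewrite (_ : EFin \o _ = fun t => (\sum_(i < n) (EFin \o f i) t)%E).
  by apply: integrable_sum.
by apply/funext => t /=; rewrite -sumEFin.
Qed.

Lemma Rintegral_bigsum (a b : R) (n : nat) (f : 'I_n -> R -> R) :
  (forall i, mu.-integrable `[a, b] (EFin \o f i)) ->
  Rintegral mu `[a, b] (fun t => \sum_(i < n) f i t) =
  \sum_(i < n) Rintegral mu `[a, b] (f i).
Proof.
elim: n f => [|n ih] f fi.
  rewrite big_ord0 (_ : (fun _ => _) = cst 0); first by rewrite Rintegral_cst// mul0r.
  by apply/funext => t; rewrite big_ord0.
rewrite big_ord_recr /= -ih//.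
rewrite -RintegralD//; last by apply: integrable_bigsum => // i; exact: fi.
by apply: eq_Rintegral => t _; rewrite big_ord_recr.
Qed.

Lemma mx_integral_mul (a b : R) (n : nat) (C D : 'M[R]_n) (F : R -> 'M[R]_n) :
  mx_cont_on a b F ->
  mx_integral a b (fun s => C *m F s *m D) = C *m mx_integral a b F *m D.
Proof.
move=> cF; apply/matrixP => i j; rewrite !mxE.
have iF k l (r : R) : mu.-integrable `[a, b] (EFin \o (fun t => r * F t k l)).
  by apply: cont_on_integrable; apply: cont_onM; [exact: cont_on_cst|exact: cF].
transitivity (Rintegral mu `[a, b]
    (fun s => \sum_l (\sum_k (C i k * D l j) * F s k l))).
  apply: eq_Rintegral => t _; rewrite mxE; apply: eq_bigr => l _.
  by rewrite mxE mulr_suml; apply: eq_bigr => k _; rewrite mulrAC.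
rewrite Rintegral_bigsum => [|l]; last first.
  apply: cont_on_integrable; apply: cont_on_sum => k.
  by apply: cont_onM; [exact: cont_on_cst|exact: cF].
apply: eq_bigr => l _; rewrite Rintegral_bigsum => [|k]; last exact: iF.
rewrite mxE mulr_suml; apply: eq_bigr => k _.
rewrite RintegralZl//; first by rewrite mxE mulrAC.
exact: cont_on_integrable (cF k l).
Qed.

Lemma mx_integral_ext (a b : R) (n : nat) (F G : R -> 'M[R]_n) :
  (forall t, a <= t <= b -> F t = G t) -> mx_integral a b F = mx_integral a b G.
Proof.
move=> FG; apply/matrixP => i j; rewrite !mxE; apply: eq_Rintegral => t.
by rewrite inE /= in_itv /= => /FG ->.
Qed.

Lemma mx_integral_id (a : R) (n : nat) (F : R -> 'M[R]_n) : mx_integral a a F = 0.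
Proof. by apply/matrixP => i j; rewrite !mxE set_itv1 Rintegral_set1. Qed.

Lemma mx_integral_derive (a b t : R) (n : nat) (F : R -> 'M[R]_n) :
  mx_cont_on a b F -> a < t < b ->
  mx_is_derive t (fun t => mx_integral a t F) (F t).
Proof.
move=> cF /andP[at_ tb] i j; have ab := lt_trans at_ tb.
rewrite (_ : (fun _ => _) = fun t => Rintegral mu `[a, t] (fun s => F s i j)); last first.
  by apply/funext => u; rewrite mxE.
have ct : {for t, continuous (fun s => F s i j)}.
  have := cF i j; move=> /(continuous_within_itvP _ ab)[h _ _]; apply: h.
  by rewrite in_itv /= at_.
have [d1 d2] := continuous_FTC1_closed tb (cont_on_integrable (cF i j)) at_ ct.
by split => //; rewrite -derive1E.
Qed.

Lemma mx_integral_cont (a b : R) (n : nat) (F : R -> 'M[R]_n) :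
  a <= b -> mx_cont_on a b F -> mx_cont_on a b (fun t => mx_integral a t F).
Proof.
move=> ab cF i j.
rewrite (_ : (fun _ => _) = fun t => Rintegral mu `[a, t] (fun s => F s i j)).
  exact: parameterized_integral_continuous (cont_on_integrable (cF i j)).
by apply/funext => u; rewrite mxE.
Qed.

Lemma mx_cont_onS (a b c d : R) (m n : nat) (F : R -> 'M[R]_(m, n)) :
  a <= c -> d <= b -> mx_cont_on a b F -> mx_cont_on c d F.
Proof. by move=> ac db cF i j; apply: cont_onS (cF i j). Qed.

Lemma mx_cont_onD (a b : R) (m n : nat) (F G : R -> 'M[R]_(m, n)) :
  mx_cont_on a b F -> mx_cont_on a b G -> mx_cont_on a b (fun t => F t + G t).
Proof.
move=> cF cG i j; rewrite (_ : (fun _ => _) = fun t => F t i j + G t i j).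
  by apply: cont_onD; [exact: cF|exact: cG].
by apply/funext => t; rewrite mxE.
Qed.

Lemma row_inj_unit (n : nat) (S : 'M[R]_n) :
  (forall v : 'rV[R]_n, v *m S = 0 -> v = 0) -> S \in unitmx.
Proof.
move=> inj; rewrite -row_free_unit -kermx_eq0; apply/rowV0P => v.
by move=> /sub_kermxP; exact: inj.
Qed.

End matrix_integral.

Section piece.
Variables (R : realType) (n : nat) (a b p q : R).
Variables (A : R -> 'M[R]_n) (Phi : R -> R -> 'M[R]_n).
Hypotheses (cA : mx_cont_on a b A) (TP : transition_matrix A a b Phi).
Hypotheses (ap : a <= p) (pq : p < q) (qb : q <= b).

Let in_ab t : p <= t <= q -> a <= t <= b.
Proof. by move=> /andP[pt tq]; rewrite (le_trans ap pt) (le_trans tq qb). Qed.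

Let pab : a <= p <= b. Proof. by apply: in_ab; rewrite lexx ltW. Qed.

Let in_ab' t : p < t < q -> a < t < b.
Proof. by move=> /andP[pt tq]; rewrite (le_lt_trans ap pt) (lt_le_trans tq qb). Qed.

(** The controllability Gramian of the system with input w = B u; its value at [q] is the matrix S
    of the piece. *)
Definition gram t := mx_integral p t (fun s => Phi p s *m (Phi p s)^T).

Let cM : mx_cont_on p q (Phi p).
Proof. exact: (mx_cont_onS ap qb (transition_cont2 cA TP pab)). Qed.

Let cMM : mx_cont_on p q (fun s => Phi p s *m (Phi p s)^T).
Proof. by apply: mx_cont_on_mul => //; exact: mx_cont_on_tr. Qed.

Let gram_derive t : p < t < q -> mx_is_derive t gram (Phi p t *m (Phi p t)^T).
Proof. exact: mx_integral_derive. Qed.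

Let gram_cont : mx_cont_on p q gram.
Proof. by apply: mx_integral_cont => //; exact: ltW. Qed.

(* By the mean value theorem, [v S v^T = 0] forces [v Phi(p, s) = 0] at some [s]. *)
Lemma gram_unit : gram q \in unitmx.
Proof.
apply: row_inj_unit => v vS.
pose g t := (v *m gram t *m v^T) 0 0.
have cg : cont_on p q g.
  have : mx_cont_on p q (fun t => v *m gram t *m v^T).
    apply: mx_cont_on_mul; last exact: mx_cont_on_cst.
    by apply: mx_cont_on_mul => //; exact: mx_cont_on_cst.
  by move=> h; exact: h.
have dg t : p < t < q -> is_derive t 1 g ((v *m (Phi p t *m (Phi p t)^T) *m v^T) 0 0).
  move=> tpq.
  have d1 : mx_is_derive t (fun t => v *m gram t) (v *m (Phi p t *m (Phi p t)^T)).
    rewrite -[v *m (_ *m _)]add0r -[X in X + _](mul0mx _ (gram t)).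
    by apply: mx_is_derive_mul; [exact: mx_is_derive_cst|exact: gram_derive].
  have := mx_is_derive_mul d1 (mx_is_derive_cst t v^T).
  by rewrite mulmx0 addr0 => h; exact: h.
have dg' t : t \in `]p, q[%R ->
    is_derive t 1 g ((v *m (Phi p t *m (Phi p t)^T) *m v^T) 0 0).
  by rewrite in_itv; exact: dg.
have [c] := MVT pq dg' cg; rewrite in_itv /= => cpq.
rewrite /g vS /gram mx_integral_id mulmx0 !mul0mx subrr => /esym/eqP.
have cab : a <= c <= b by apply: in_ab; case/andP: cpq => /ltW -> /ltW ->.
rewrite mulf_eq0 subr_eq0 (gt_eqF pq) orbF mulmxA -mulmxA -trmx_mul.
set u := v *m Phi p c; rewrite mxE; under eq_bigr do rewrite [u^T _ _]mxE -expr2.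
rewrite psumr_eq0 => [/allP h|k _]; last exact: sqr_ge0.
have vM : u = 0.
  apply/matrixP => i j; rewrite ord1 [RHS]mxE; apply/eqP.
  by have := h j (mem_index_enum _); rewrite sqrf_eq0.
by rewrite -[v]mulmx1 -(transition_inv cA TP pab cab) mulmxA -/u vM mul0mx.
Qed.

Variables (xp xq : 'cV[R]_n).
(** The costate at [p]: by variation of constants, the input Phi(p, s)^T c reaches [xq] exactly when
    [gram q] maps c to Phi(p, q) xq - xp. *)
Definition piece_mult := invmx (gram q) *m (Phi p q *m xq - xp).
Definition piece_traj t := Phi t p *m xp +
  mx_integral p t (fun s => Phi t s *m (Phi p s)^T) *m piece_mult.

(** In [piece_traj] the time occurs both as a bound and inside the integrand. Factoring out Phi(t,
    p) leaves an integral with a fixed integrand, ready for the fundamental theorem and the product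
    rule. *)
Let X t := Phi t p *m (xp + gram t *m piece_mult).

Let piece_trajE t : p <= t <= q -> X t = piece_traj t.
Proof.
move=> tpq; have tab := in_ab tpq; rewrite /X /piece_traj mulmxDr mulmxA.
congr (_ + _ *m _); rewrite -[_ *m gram t]mulmx1 -mx_integral_mul; last first.
  by case/andP: tpq => _ tq; exact: mx_cont_onS cMM.
apply: mx_integral_ext => s /andP[ps st].
rewrite mulmx1 mulmxA (transition_comp cA TP)//.
by apply: in_ab; rewrite ps (le_trans st)//; case/andP: tpq.
Qed.

Lemma piece_traj_start : piece_traj p = xp.
Proof.
rewrite /piece_traj mx_integral_id mul0mx addr0.
by rewrite (transition_id TP) ?mul1mx.
Qed.

Lemma piece_traj_end : piece_traj q = xq.
Proof.
have qab : a <= q <= b by apply: in_ab; rewrite lexx ltW.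
rewrite -piece_trajE ?lexx ?ltW// /X /piece_mult mulKVmx ?gram_unit//.
by rewrite addrC subrK mulmxA (transition_inv cA TP) ?mul1mx.
Qed.

Let X_derive t : p < t < q ->
  mx_is_derive t X (A t *m X t + (Phi p t)^T *m piece_mult).
Proof.
move=> tpq; have tab := in_ab' tpq.
have tab' : a <= t <= b by case/andP: tab => /ltW -> /ltW ->.
have d1 : mx_is_derive t (fun t => xp + gram t *m piece_mult)
    (0 + (Phi p t *m (Phi p t)^T *m piece_mult + gram t *m 0)).
  apply: mx_is_deriveD; first exact: mx_is_derive_cst.
  by apply: mx_is_derive_mul; [exact: gram_derive|exact: mx_is_derive_cst].
have := mx_is_derive_mul (transition_derive TP pab tab) d1.
rewrite mulmx0 addr0 add0r !mulmxA (transition_inv cA TP)// mul1mx.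
by rewrite -(mulmxA (A t)); apply.
Qed.

Lemma piece_traj_derive t : p < t < q ->
  mx_is_derive t piece_traj (A t *m piece_traj t + (Phi p t)^T *m piece_mult).
Proof.
move=> /[dup] tpq /andP[pt tq] i j; rewrite -(piece_trajE) ?ltW//.
apply: near_eq_is_derive (X_derive tpq i j).
have : \forall u \near t, u \in `]p, q[ by apply: near_in_itvoo; rewrite in_itv.
apply: filterS => u; rewrite in_itv /= => /andP[pu uq].
by rewrite piece_trajE// !ltW.
Qed.

Lemma piece_traj_lipschitz i : lipschitz_in p q (fun t => piece_traj t i 0).
Proof.
have cX : mx_cont_on p q X.
  apply: mx_cont_on_mul; first exact: (mx_cont_onS ap qb (transition_cont TP pab)).
  apply: mx_cont_onD; first exact: mx_cont_on_cst.
  by apply: mx_cont_on_mul => //; exact: mx_cont_on_cst.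
have [K K0 KP] : lipschitz_in p q (fun t => X t i 0).
  apply: (@bounded_derive_lipschitz _ _ _ _
    (fun t => (A t *m X t + (Phi p t)^T *m piece_mult) i 0)).
  - exact: cX.
  - have : mx_cont_on p q (fun t => A t *m X t + (Phi p t)^T *m piece_mult).
      apply: mx_cont_onD; first by apply: mx_cont_on_mul => //; exact: mx_cont_onS cA.
      by apply: mx_cont_on_mul; [exact: mx_cont_on_tr|exact: mx_cont_on_cst].
    by move=> h; exact: h.
  - by move=> t tpq; exact: X_derive.
exists K => // s t ps st tq; rewrite -!piece_trajE ?KP//.
  by rewrite ps (le_trans st).
by rewrite tq (le_trans ps).
Qed.

End piece.

(** * Gluing along the partition *)

(** The default [y] matters for the control: its bound is required on the whole line, also outside
    the partition. *)
Lemma glue_functions (I S T : Type) (P : I -> S -> Prop) (f : I -> S -> T) (y : T) :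
  (forall t i j, P i t -> P j t -> f i t = f j t) ->
  exists g : S -> T, (forall i t, P i t -> g t = f i t) /\
    (forall t, (forall i, ~ P i t) -> g t = y).
Proof.
move=> fP; exists (fun t => if pselect (exists i, P i t) is left h
  then f (sval (cid h)) t else y); split=> [i t Pit|t nP].
  by case: pselect => [h|[]]; [exact: fP (svalP (cid h)) Pit|exists i].
by case: pselect => // h; have [i Pi] := h; case: (nP i Pi).
Qed.

Lemma lipschitz_in_join (R : realType) (a b c : R) (f : R -> R) :
  a <= c -> c <= b ->
  lipschitz_in a c f -> lipschitz_in c b f -> lipschitz_in a b f.
Proof.
move=> ac cb [K K0 KP] [L L0 LP]; exists (K + L); first exact: addr_gt0.
move=> s t as_ st tb; rewrite mulrDl.
have KL0 (u : R) : 0 <= u -> 0 <= K * u /\ 0 <= L * u.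
  by move=> u0; split; apply: mulr_ge0 => //; exact: ltW.
have [|] := KL0 (t - s); first by rewrite subr_ge0.
move=> Ks Ls; have [tc|/ltW ct] := leP t c.
  by have := KP s t as_ st tc; lra.
have [cs|/ltW sc] := leP c s; first by have := LP s t cs st tb; lra.
have -> : f t - f s = (f t - f c) + (f c - f s) by ring.
apply: le_trans (ler_normD _ _) _.
have h1 := KP s c as_ sc (lexx c); have h2 := LP c t (lexx c) ct tb.
have [|h3 _] := KL0 (t - c); first by rewrite subr_ge0.
have [|_ h4] := KL0 (c - s); first by rewrite subr_ge0.
rewrite !mulrBr in h1 h2 h3 h4 Ks Ls *; lra.
Qed.

Lemma ae_neq (R : realType) (c : R) :
  {ae (@lebesgue_measure R), forall t : R, t != c}.
Proof.
have : mu.-negligible [set c].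
  by apply/negligibleP; [exact: measurable_set1|exact: lebesgue_measure_set1].
apply: negligibleS => t /= /negP; rewrite negbK => /eqP ->; exact: erefl.
Qed.

Section mesh.
Variables (R : realType) (m : nat) (tp : nat -> R).
Hypothesis tpS : forall i, (i < m)%N -> tp i < tp i.+1.

Lemma mesh_le i j : (i <= j)%N -> (j <= m)%N -> tp i <= tp j.
Proof.
elim: j => [|j ih]; first by rewrite leqn0 => /eqP ->.
rewrite leq_eqVlt => /predU1P[-> //|ij] jm.
exact: le_trans (ih ij (ltnW jm)) (ltW (tpS jm)).
Qed.

Lemma mesh_lipschitz (f : R -> R) :
  (forall i, (i < m)%N -> lipschitz_in (tp i) (tp i.+1) f) ->
  lipschitz_in (tp 0%N) (tp m) f.
Proof.
move=> fL; suff : forall k, (k <= m)%N -> lipschitz_in (tp 0%N) (tp k) f by apply.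
elim=> [_|k ih km].
  exists 1 => // s t s0 st t0; have -> : s = t by apply/le_anti; rewrite st (le_trans t0).
  by rewrite !subrr normr0 mulr0.
apply: (@lipschitz_in_join _ _ _ (tp k)); [exact: mesh_le (ltnW km)|exact: mesh_le|
  exact: ih (ltnW km)|exact: fL].
Qed.

(** The nodes have to be discarded because the costate, and with it the derivative of the state, may
    jump there. *)
Lemma mesh_ae :
  {ae (@lebesgue_measure R), forall t, tp 0%N <= t <= tp m ->
    exists2 i, (i < m)%N & tp i < t < tp i.+1}.
Proof.
suff : forall k, (k <= m)%N -> {ae (@lebesgue_measure R), forall t,
    tp 0%N <= t <= tp k -> exists2 i, (i < k)%N & tp i < t < tp i.+1}.
  by apply.
elim=> [_|k ih km].
  apply: ae_lebesgue1 (ae_neq (tp 0%N)) => t /eqP h /le_anti e.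
  by exfalso; apply: h.
apply: ae_lebesgue2 (ih (ltnW km)) (ae_neq (tp k.+1)) => t tP tk /andP[t0 tk1].
have [tk2|kt] := leP t (tp k).
  by have [|i ik it] := tP; [rewrite t0|exists i => //; exact: ltnW].
by exists k => //; rewrite kt lt_neqAle tk.
Qed.

(** Left-open pieces are those on which the glued control follows a single formula; the left end of
    the partition remains as one extra point. *)
Lemma mesh_measurable (f : R -> R) :
  (forall i, (i < m)%N -> measurable_fun `]tp i, tp i.+1] f) ->
  measurable_fun `[tp 0%N, tp m] f.
Proof.
move=> fM; suff h : forall k, (k <= m)%N -> measurable_fun `]tp 0%N, tp k] f.
  by apply/measurable_fun_itv_obnd_cbndP; exact: h.
elim=> [_|k ih km]; first by rewrite set_itvoc0; exact: measurable_fun_set0.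
have -> : `]tp 0%N, tp k.+1]%classic = `]tp 0%N, tp k]%classic `|` `]tp k, tp k.+1]%classic.
  by apply: itv_bndbnd_setU; rewrite bnd_simp; apply: mesh_le => //; exact: ltnW.
by apply/measurable_funU => //; split; [exact: ih (ltnW km)|exact: fM].
Qed.

Lemma mesh_Rintegral0 (g : R -> R) :
  mu.-integrable `[tp 0%N, tp m] (EFin \o g) ->
  (forall i, (i < m)%N -> Rintegral mu `[tp i, tp i.+1] g = 0) ->
  Rintegral mu `[tp 0%N, tp m] g = 0.
Proof.
move=> ig g0.
suff : forall k, (k <= m)%N -> Rintegral mu `[tp 0%N, tp k] g = 0 by apply.
elim=> [_|k ih km]; first by rewrite set_itv1 Rintegral_set1.
have iS b c d : (b <= m)%N -> tp 0%N <= c -> d <= tp b ->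
    forall x y, mu.-integrable [set` Interval (BSide x c) (BSide y d)] (EFin \o g).
  move=> bm c0 db x y; apply: integrableS ig => //.
  move=> t /=; rewrite !itv_boundlr /= => /andP[h1 h2]; apply/andP; split.
    by apply: le_trans h1; rewrite bnd_simp.
  apply: (le_trans h2); rewrite bnd_simp.
  by apply: le_trans db _; exact: mesh_le.
have := @Rintegral_itvB _ g (BLeft (tp 0%N)) (BRight (tp k.+1)) (tp k).
rewrite ih ?(ltnW km)// subr0 => -> //.
- rewrite Rintegral_itv_obnd_cbnd ?g0//.
  by apply: (iS k.+1) => //; apply: mesh_le => //; exact: ltnW.
- exact: (iS k.+1).
- by rewrite bnd_simp mesh_le// ltnW.
- by rewrite bnd_simp ltW// tpS.
Qed.

End mesh.

Section measurable_entries.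
Variables (R : realType) (n : nat).

Lemma measurable_mulmx (D : set R) (F : R -> 'M[R]_n) (G : R -> 'cV[R]_n) :
  (forall i j, measurable_fun D (fun t => F t i j)) ->
  (forall i, measurable_fun D (fun t => G t i 0)) ->
  forall i, measurable_fun D (fun t => (F t *m G t) i 0).
Proof.
move=> mF mG i; rewrite (_ : (fun _ => _) = fun t => \sum_k F t i k * G t k 0).
  by apply: measurable_sum => k; exact: measurable_funM.
by apply/funext => t; rewrite mxE.
Qed.

Lemma mx_cont_on_measurable (a b : R) (F : R -> 'M[R]_n) :
  mx_cont_on a b F -> forall i j, measurable_fun `[a, b] (fun t => F t i j).
Proof. by move=> cF i j; apply: subspace_continuous_measurable_fun => //; exact: cF. Qed.

End measurable_entries.

(** * Optimality *)

Section pairing.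
Variables (R : realType) (n : nat) (a b p q : R).
Variables (A : R -> 'M[R]_n) (Phi : R -> R -> 'M[R]_n).
Hypotheses (cA : mx_cont_on a b A) (TP : transition_matrix A a b Phi).
Hypotheses (ap : a <= p) (pq : p <= q) (qb : q <= b).
Variables (d w : R -> 'cV[R]_n) (c : 'cV[R]_n).
Hypothesis acd : forall k, abs_cont_on p q (fun t => d t k 0).
Hypothesis dd : {ae (@lebesgue_measure R), forall t, p < t < q ->
  mx_is_derive t d (A t *m d t + w t)}.

Let pab : a <= p <= b. Proof. by rewrite ap (le_trans pq qb). Qed.

(** The inner product of the costate Phi(p, t)^T c with [d]. The vector [c] is left free: optimality
    takes the multiplier of the piece, uniqueness takes every basis vector. *)
Definition costate_pairing t := (c^T *m Phi p t *m d t) 0 0.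

Let lab t : p < t < q -> a < t < b.
Proof. by move=> /andP[pt tq]; rewrite (le_lt_trans ap pt) (lt_le_trans tq qb). Qed.

Lemma costate_pairing_abs_cont : abs_cont_on p q costate_pairing.
Proof.
have cP : mx_cont_on p q (Phi p).
  exact: (mx_cont_onS ap qb (transition_cont2 cA TP pab)).
rewrite (_ : costate_pairing =
  fun t => \sum_k (\sum_j c j 0 * Phi p t j k) * d t k 0); last first.
  apply/funext => t; rewrite /costate_pairing mxE; apply: eq_bigr => k _.
  by rewrite mxE; congr (_ * _); apply: eq_bigr => j _; rewrite mxE.
apply: abs_cont_on_sum => k; apply: abs_cont_onM => //.
apply: abs_cont_on_sum => j; apply: abs_cont_onM => //.
  exact: abs_cont_on_cst.
apply: lipschitz_in_abs_cont.
apply: (@bounded_derive_lipschitz _ _ _ _ (fun t => (- (Phi p t *m A t)) j k)).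
- exact: cP.
- rewrite (_ : (fun _ => _) = fun t => -1 * (Phi p t *m A t) j k); last first.
    by apply/funext => t; rewrite mxE mulN1r.
  apply: cont_onM; first exact: cont_on_cst.
  by apply: mx_cont_on_mul => //; exact: mx_cont_onS cA.
- by move=> t /lab tab; exact: (transition_derive2 cA TP pab tab).
Qed.

(** The terms in [A] cancel, because the costate solves the adjoint equation. *)
Lemma costate_pairing_derive :
  {ae (@lebesgue_measure R), forall t, p < t < q ->
    is_derive t 1 costate_pairing ((c^T *m Phi p t *m w t) 0 0)}.
Proof.
apply: ae_lebesgue1 dd => t dt tpq.
have d1 : mx_is_derive t (fun t => c^T *m Phi p t) (c^T *m - (Phi p t *m A t)).
  rewrite -[c^T *m - _]add0r -[X in X + _](mul0mx _ (Phi p t)).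
  apply: mx_is_derive_mul; first exact: mx_is_derive_cst.
  exact: (transition_derive2 cA TP pab (lab tpq)).
have := mx_is_derive_mul d1 (dt tpq) 0 0.
by rewrite mulmxN mulNmx mulmxDr !mulmxA addKr.
Qed.

End pairing.

Lemma EFin_Rintegral (R : realType) (a b : R) (f : R -> R) :
  mu.-integrable `[a, b] (EFin \o f) ->
  (\int[mu]_(t in `[a, b]) (f t)%:E)%E = (Rintegral mu `[a, b] f)%:E.
Proof. by move=> fi; rewrite fineK//; exact: integrable_fin_num. Qed.

Section admissible.
Variables (R : realType) (n : nat) (a b p q : R) (A B : R -> 'M[R]_n).
Hypotheses (ap : a <= p) (pq : p <= q) (qb : q <= b).

Lemma solves_sub (y v x u : R -> 'cV[R]_n) :
  solves A B a b y v -> solves A B a b x u ->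
  (forall k, abs_cont_on p q (fun t => (y t - x t) k 0)) /\
  {ae (@lebesgue_measure R), forall t, p < t < q ->
     mx_is_derive t (fun t => y t - x t)
       (A t *m (y t - x t) + (B t *m v t - B t *m u t))}.
Proof.
move=> [_ [acy dy]] [_ [acx dx]]; split=> [k|].
  rewrite (_ : (fun _ => _) = fun t => y t k 0 - x t k 0).
    by apply: abs_cont_onB => //; apply: abs_cont_onS ap qb _; [exact: acy|exact: acx].
  by apply/funext => t; rewrite !mxE.
apply: ae_lebesgue2 dy dx => t dyt dxt /andP[pt tq].
have tab : a <= t <= b by rewrite (le_trans ap (ltW pt)) (le_trans (ltW tq) qb).
have -> : A t *m (y t - x t) + (B t *m v t - B t *m u t) =
    A t *m y t + B t *m v t - (A t *m x t + B t *m u t).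
  by rewrite mulmxBr opprD addrACA.
apply: mx_is_deriveD; [|apply: mx_is_deriveN]; move=> i j; rewrite (ord1 j).
  by have [d1 d2] := dyt tab i; split => //; rewrite -derive1E.
by have [d1 d2] := dxt tab i; split => //; rewrite -derive1E.
Qed.

End admissible.

Section optimum.
Variables (R : realType) (n m : nat) (tp : nat -> R) (xp : nat -> 'cV[R]_n).
Variables (A B : R -> 'M[R]_n) (Phi : R -> R -> 'M[R]_n).
Hypotheses (tpS : forall i, (i < m)%N -> tp i < tp i.+1).
Local Notation a := (tp 0%N).
Local Notation b := (tp m).
Hypotheses (m0 : (0 < m)%N) (uB : forall t, a <= t <= b -> B t \in unitmx).
Hypotheses (cA : mx_cont_on a b A) (cB : mx_cont_on a b B).
Hypothesis TP : transition_matrix A a b Phi.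

Let c i := piece_mult (tp i) (tp i.+1) Phi (xp i) (xp i.+1).
Let xs i := piece_traj (tp i) (tp i.+1) Phi (xp i) (xp i.+1).

Let ap i : (i < m)%N -> a <= tp i.
Proof. by move=> im; apply: (mesh_le tpS) => //; exact: ltnW. Qed.
Let qb i : (i < m)%N -> tp i.+1 <= b.
Proof. by move=> im; apply: (mesh_le tpS). Qed.
Let pab i : (i < m)%N -> a <= tp i <= b.
Proof. by move=> im; rewrite ap//; apply: (mesh_le tpS) => //; exact: ltnW. Qed.

(** The state formulas agree at shared nodes, so closed pieces are consistent; the costates may
    disagree there, so [w] follows each formula on a left-open piece. Measurability and the uniform
    bound make [w] square integrable. *)
Definition is_candidate (x w : R -> 'cV[R]_n) :=
  [/\ forall i t, (i < m)%N -> tp i <= t <= tp i.+1 -> x t = xs i t,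
      forall i t, (i < m)%N -> tp i < t <= tp i.+1 -> w t = (Phi (tp i) t)^T *m c i,
      forall k, measurable_fun `[a, b] (fun t => w t k 0) &
      exists K, forall t k, `|w t k 0| <= K].

Lemma candidate_exists : exists x w, is_candidate x w.
Proof.
have [w [wP w0]] : exists w : R -> 'cV[R]_n,
    (forall i t, (i < m)%N /\ tp i < t <= tp i.+1 -> w t = (Phi (tp i) t)^T *m c i) /\
    (forall t, (forall i, ~ ((i < m)%N /\ tp i < t <= tp i.+1)) -> w t = 0).
  apply: (@glue_functions nat R _ (fun i t => (i < m)%N /\ tp i < t <= tp i.+1)
    (fun i t => (Phi (tp i) t)^T *m c i) 0) => t i j.
  have disj k l : (k < l)%N -> (l < m)%N -> t <= tp k.+1 -> tp l < t -> False.
    move=> kl lm tk lt_; have := mesh_le tpS kl (ltnW lm).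
    by rewrite leNgt (lt_le_trans lt_ tk).
  move=> [im /andP[it ti]] [jm /andP[jt tj]].
  by have [ij|ji|->//] := ltngtP i j; exfalso; [exact: (disj i j)|exact: (disj j i)].
have [x [xP _]] : exists x : R -> 'cV[R]_n,
    (forall i t, (i < m)%N /\ tp i <= t <= tp i.+1 -> x t = xs i t) /\
    (forall t, (forall i, ~ ((i < m)%N /\ tp i <= t <= tp i.+1)) -> x t = 0).
  apply: (@glue_functions nat R _ (fun i t => (i < m)%N /\ tp i <= t <= tp i.+1) xs 0) => t i j.
  (* Two distinct pieces meet only if they are consecutive and [t] is their common node, where the
     end of one trajectory is the start of the next. *)
  have agree k l : (k < l)%N -> (l < m)%N -> t <= tp k.+1 -> tp l <= t -> xs k t = xs l t.
    move=> kl lm tk lt_; have km := ltn_trans kl lm.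
    have tE : t = tp k.+1.
      by apply/le_anti; rewrite tk (le_trans _ lt_)//; apply: (mesh_le tpS) => //; exact: ltnW.
    have lE : l = k.+1.
      apply/eqP; rewrite eqn_leq kl andbT leqNgt; apply/negP => kl2.
      have := lt_le_trans (tpS (leq_ltn_trans kl lm)) (mesh_le tpS kl2 (ltnW lm)).
      by rewrite ltNge (le_trans lt_ tk).
    rewrite lE tE /xs (piece_traj_end cA TP) ?ap ?qb ?tpS//.
    rewrite (piece_traj_start TP) ?lexx//; first by rewrite ap// -lE.
    - by rewrite tpS// -lE.
    - by rewrite qb// -lE.
  move=> [im /andP[it ti]] [jm /andP[jt tj]].
  by have [ij|ji|->//] := ltngtP i j; [exact: agree|apply/esym; exact: agree].
exists x, w; split.
- by move=> i t im tI; exact: xP.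
- by move=> i t im tI; exact: wP.
- move=> k; apply: (mesh_measurable tpS) => i im.
  apply: (@eq_measurable_fun _ _ _ _ _ (fun t => ((Phi (tp i) t)^T *m c i) k 0)).
    by move=> t; rewrite inE /= in_itv /= => tI; rewrite (wP i).
  apply: (@measurable_funS _ _ _ _ `[a, b]) => //.
    move=> t /=; rewrite !in_itv /= => /andP[it ti].
    by rewrite (le_trans (ap im) (ltW it)) (le_trans ti (qb im)).
  apply: measurable_mulmx => [i' j|i']; last exact: measurable_cst.
  by apply: mx_cont_on_measurable; apply: mx_cont_on_tr; exact: (transition_cont2 cA TP (pab im)).
- have h (i : 'I_m) k : exists K : R, 0 < K /\ forall t, a <= t <= b ->
      `|((Phi (tp i) t)^T *m c i) k 0| <= K.
    have cw : mx_cont_on a b (fun t => (Phi (tp i) t)^T *m c i).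
      apply: mx_cont_on_mul; last exact: mx_cont_on_cst.
      by apply: mx_cont_on_tr; exact: (transition_cont2 cA TP (pab (ltn_ord i))).
    have [K K0 KP] := cont_on_bounded (mesh_le tpS (leq0n m) (leqnn m)) (cw k 0).
    by exists K.
  pose K i k := sval (cid (h i k)).
  have KP i k := svalP (cid (h i k)) :
    0 < K i k /\ forall t, a <= t <= b -> `|((Phi (tp i) t)^T *m c i) k 0| <= K i k.
  have K0 i k : 0 <= K i k by apply: ltW; have [] := KP i k.
  exists (\sum_i \sum_k K i k) => t k.
  have [[i [im it]]|nt] := pselect (exists i, (i < m)%N /\ tp i < t <= tp i.+1).
    rewrite (wP i)//; have [_ /(_ t)] := KP (Ordinal im) k.
    move=> /(_ _)/le_trans; apply.
      case/andP: it => it ti.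
      by rewrite (le_trans (ap im) (ltW it)) (le_trans ti (qb im)).
    rewrite (bigD1 (Ordinal im)) //= (bigD1 k) //= -addrA lerDl addr_ge0//.
      by apply: sumr_ge0.
    by apply: sumr_ge0 => i' _; apply: sumr_ge0.
  rewrite w0 => [|i it]; last by apply: nt; exists i.
  by rewrite mxE normr0; apply: sumr_ge0 => i _; apply: sumr_ge0.
Qed.

Variables (x w : R -> 'cV[R]_n).
Hypothesis xw : is_candidate x w.

Let u t := invmx (B t) *m w t.

Let Bu t : a <= t <= b -> B t *m u t = w t.
Proof. by move=> tab; rewrite mulKVmx ?uB. Qed.

Lemma candidate_admissible : admissible A B m tp xp x u.
Proof.
have [xP wP mw _] := xw; split; last first.
  (* The last node starts no piece; it is reached as the end of piece [m.-1]. *)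
  move=> i; rewrite leq_eqVlt => /predU1P[->|im].
    have m1 : (m.-1 < m)%N by rewrite prednK.
    have mE : m.-1.+1 = m by rewrite prednK.
    rewrite (xP m.-1)//; last by rewrite mE lexx andbT ltW// -[in ltRHS]mE tpS.
    rewrite /xs -{1}[in LHS]mE.
    have := @piece_traj_end _ _ a b (tp m.-1) (tp m.-1.+1) A Phi cA TP (ap m1) (tpS m1)
      (qb m1) (xp m.-1) (xp m.-1.+1).
    by rewrite mE.
  rewrite (xP i)//; last by rewrite lexx ltW ?tpS.
  by rewrite /xs (piece_traj_start TP) ?ap ?qb ?tpS.
split; [|split].
- move=> k; apply: measurable_mulmx => //.
  by apply: mx_cont_on_measurable; exact: mx_cont_on_inv.
- move=> k; apply: lipschitz_in_abs_cont; apply: (mesh_lipschitz tpS) => i im.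
  have [K K0 KP] := piece_traj_lipschitz cA TP (ap im) (tpS im) (qb im) (xp i) (xp i.+1) k.
  exists K => // s t s0 st t0.
  rewrite !(xP i) ?KP// ?s0 ?t0 ?(le_trans st)//; first by rewrite (le_trans s0 st).
- apply: ae_lebesgue1 (mesh_ae m tp) => t tI tab k.
  have [i im /[dup] tpq /andP[it ti]] := tI tab.
  have tpq' : tp i <= t <= tp i.+1 by rewrite !ltW.
  have : is_derive t 1 (fun s => x s k 0) ((A t *m x t + B t *m u t) k 0).
    rewrite Bu// (wP i t im) ?it ?(ltW ti)// (xP i t im)//.
    apply: near_eq_is_derive
      (piece_traj_derive cA TP (ap im) (tpS im) (qb im) (xp i) (xp i.+1) tpq k 0).
    have : \forall s \near t, s \in `]tp i, tp i.+1[ by apply: near_in_itvoo; rewrite in_itv.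
    by apply: filterS => s; rewrite in_itv /= => /andP[si is_]; rewrite (xP i)// !ltW.
  by move=> [d1 d2]; split => //; rewrite derive1E.
Qed.

Lemma candidate_sqr_integrable k :
  mu.-integrable `[a, b] (EFin \o (fun t => w t k 0 ^+ 2)).
Proof.
have [_ _ mw [K KP]] := xw; apply: measurable_bounded_integrable => //.
- rewrite [ltLHS](_ : _ = mu (`[a, b]%classic : set R))// lebesgue_measure_itv /=.
  by case: ifP => _; rewrite ?ltry// -EFinB ltry.
- by apply: measurable_funX; exact: mw.
- exists (K ^+ 2); split; first exact: num_real.
  move=> N KN t _; apply: le_trans (ltW KN).
  by rewrite normrX lerXn2r ?nnegrE// (le_trans _ (KP t k)).
Qed.

Lemma candidate_cost : cost B a b u =
  (Rintegral mu `[a, b] (fun t => \sum_k w t k 0 ^+ 2))%:E.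
Proof.
rewrite -EFin_Rintegral; last first.
  by apply: integrable_bigsum => // k; exact: candidate_sqr_integrable.
by apply: eq_integral => t; rewrite inE /= in_itv /= => /Bu ->.
Qed.

(* The cross term vanishes: on each piece it integrates the derivative of the
   pairing of the costate with [y - x], which is [0] at both nodes. *)
Lemma candidate_pythagoras (y v : R -> 'cV[R]_n) :
  admissible A B m tp xp y v -> (cost B a b v < +oo)%E ->
  exists2 r, mu.-integrable `[a, b]
      (EFin \o (fun t => \sum_k ((B t *m v t - w t) k 0) ^+ 2)) /\
    r = Rintegral mu `[a, b] (fun t => \sum_k ((B t *m v t - w t) k 0) ^+ 2) &
    cost B a b v = (cost B a b u + r%:E)%E.
Proof.
move=> [sy yn] cv; have [xP wP mw [K KP]] := xw.
have [sx xn] := candidate_admissible.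
pose W t := B t *m v t.
have mW k : measurable_fun `[a, b] (fun t => W t k 0).
  apply: measurable_mulmx; first exact: mx_cont_on_measurable.
  by case: sy.
(* Finiteness of the cost enters here: it makes [W] square integrable, so the integrals below can be
   split. *)
have iSW : mu.-integrable `[a, b] (EFin \o (fun t => \sum_k W t k 0 ^+ 2)).
  apply/integrableP; split.
    by apply/measurable_EFinP; apply: measurable_sum => k; apply: measurable_funX; exact: mW.
  apply: le_lt_trans cv; rewrite le_eqVlt; apply/orP; left; apply/eqP.
  apply: eq_integral => t _ /=; rewrite ger0_norm//.
  by apply: sumr_ge0 => k _; exact: sqr_ge0.
have iW2 k : mu.-integrable `[a, b] (EFin \o (fun t => W t k 0 ^+ 2)).
  apply: le_integrable iSW => //.
    by apply/measurable_EFinP; apply: measurable_funX; exact: mW.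
  move=> t _ /=; rewrite lee_fin !ger0_norm ?sqr_ge0//.
    by rewrite (bigD1 k) //= lerDl; apply: sumr_ge0 => j _; exact: sqr_ge0.
  by apply: sumr_ge0 => j _; exact: sqr_ge0.
have iw2 := candidate_sqr_integrable.
have iD f g : mu.-integrable `[a, b] (EFin \o f) -> mu.-integrable `[a, b] (EFin \o g) ->
    mu.-integrable `[a, b] (EFin \o (fun t => f t + g t)).
  move=> fi gi; have -> : EFin \o (fun t => f t + g t) = ((EFin \o f) \+ (EFin \o g))%E.
    by apply/funext => t; rewrite /= ?EFinD ?EFinB.
  exact: integrableD.
have iB f g : mu.-integrable `[a, b] (EFin \o f) -> mu.-integrable `[a, b] (EFin \o g) ->
    mu.-integrable `[a, b] (EFin \o (fun t => f t - g t)).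
  move=> fi gi; have -> : EFin \o (fun t => f t - g t) = ((EFin \o f) \- (EFin \o g))%E.
    by apply/funext => t; rewrite /= ?EFinD ?EFinB.
  exact: integrableB.
have iwW k : mu.-integrable `[a, b] (EFin \o (fun t => w t k 0 * W t k 0)).
  apply: le_integrable (iD _ _ (iw2 k) (iW2 k)) => //.
    by apply/measurable_EFinP; apply: measurable_funM; [exact: mw|exact: mW].
  move=> t _ /=; rewrite lee_fin [leRHS]ger0_norm ?addr_ge0 ?sqr_ge0//.
  rewrite ler_norml; apply/andP; split.
    have := sqr_ge0 (w t k 0 + W t k 0); have := sqr_ge0 (w t k 0).
    by have := sqr_ge0 (W t k 0); rewrite !expr2; lra.
  have := sqr_ge0 (w t k 0 - W t k 0); have := sqr_ge0 (w t k 0).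
  by have := sqr_ge0 (W t k 0); rewrite !expr2; lra.
(* [g] is the cross term <w, W - w>. *)
pose g t := \sum_k (w t k 0 * W t k 0 - w t k 0 ^+ 2).
have ig : mu.-integrable `[a, b] (EFin \o g).
  by apply: integrable_bigsum => // k; exact: (iB).
pose Q t := \sum_k ((W t - w t) k 0) ^+ 2.
have QE t : Q t = (\sum_k W t k 0 ^+ 2 - g t) - g t - \sum_k w t k 0 ^+ 2.
  rewrite /Q /g -!sumrB; apply: eq_bigr => k _; rewrite !mxE.
  by rewrite !expr2; ring.
have iQ : mu.-integrable `[a, b] (EFin \o Q).
  rewrite (_ : Q = fun t => (\sum_k W t k 0 ^+ 2 - g t) - g t - \sum_k w t k 0 ^+ 2).
    apply: (iB); first by apply: (iB) => //; exact: (iB).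
    by apply: integrable_bigsum.
  exact/funext.
have g0 : Rintegral mu `[a, b] g = 0.
  apply: (mesh_Rintegral0 tpS ig) => i im.
  have lti := tpS im.
  have [acd dd] := solves_sub (ap im) (ltW lti) (qb im) sy sx.
  pose f := costate_pairing (tp i) Phi (fun t => y t - x t) (c i).
  have acf : abs_cont_on (tp i) (tp i.+1) f.
    exact: (costate_pairing_abs_cont cA TP (ap im) (ltW lti) (qb im)).
  have df := costate_pairing_derive cA TP (ap im) (ltW lti) (qb im) (c i) dd.
  have -> : Rintegral mu `[tp i, tp i.+1] g = f (tp i.+1) - f (tp i).
    apply: (abs_cont_FTC (ltW lti) acf).
      apply: integrableS ig => // t /=; rewrite !in_itv /= => /andP[it ti].
      by rewrite (le_trans (ap im) it) (le_trans ti (qb im)).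
    apply: ae_lebesgue1 df => t ft /[dup] tpq /andP[it ti].
    have tab : a <= t <= b.
      by rewrite (le_trans (ap im) (ltW it)) (le_trans (ltW ti) (qb im)).
    rewrite [X in is_derive _ _ _ X](_ : _ =
      ((c i)^T *m Phi (tp i) t *m (B t *m v t - B t *m u t)) 0 0); first exact: ft.
    rewrite Bu// -/(W t) (_ : (c i)^T *m _ = (w t)^T).
      rewrite /g mxE; apply: eq_bigr => k _; rewrite !mxE expr2; ring.
    by rewrite (wP i)// ?it ?(ltW ti)// [RHS]trmx_mul trmxK.
  by rewrite /f /costate_pairing !yn ?xn ?subrr ?mulmx0 ?mxE ?subrr// ltnW.
exists (Rintegral mu `[a, b] Q); first by split.
rewrite candidate_cost -EFinD.
transitivity ((Rintegral mu `[a, b] (fun t => \sum_k W t k 0 ^+ 2))%:E).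
  by rewrite -EFin_Rintegral.
congr (_%:E); rewrite (_ : Q = fun t => (\sum_k W t k 0 ^+ 2 - g t) - g t -
    \sum_k w t k 0 ^+ 2); last exact/funext.
rewrite RintegralB//; last 2 first.
- by apply: (iB) => //; exact: (iB).
- by apply: integrable_bigsum.
rewrite RintegralB//; last exact: (iB).
by rewrite RintegralB// g0; ring.
Qed.

Lemma candidate_cost_lty : (cost B a b u < +oo)%E.
Proof. by rewrite candidate_cost ltry. Qed.

Lemma candidate_optimal : optimal A B m tp xp x u.
Proof.
split; first exact: candidate_admissible.
(* A competitor of infinite cost is beaten trivially; the others fall under Pythagoras. *)
move=> y v yv; have [cv|] := ltP (cost B a b v) +oo%E; last first.
  by rewrite leye_eq => /eqP ->; exact: leey.
have [r [_ ->] ->] := candidate_pythagoras yv cv.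
rewrite leeDl// lee_fin; apply: Rintegral_ge0 => t _.
by apply: sumr_ge0 => k _; exact: sqr_ge0.
Qed.

(** Comparison with the candidate makes the Pythagorean remainder nonpositive, and an integral of
    squares that is nonpositive has an integrand vanishing almost everywhere. *)
Lemma optimal_control_unique (y v : R -> 'cV[R]_n) : optimal A B m tp xp y v ->
  {ae (@lebesgue_measure R), forall t, a <= t <= b -> B t *m v t = w t}.
Proof.
move=> [yv /(_ x u candidate_admissible) cvu].
have cv := le_lt_trans cvu candidate_cost_lty.
have [r [iQ rE] cE] := candidate_pythagoras yv cv.
pose Q t := \sum_k ((B t *m v t - w t) k 0) ^+ 2.
have Q0 t : 0 <= Q t by apply: sumr_ge0 => k _; exact: sqr_ge0.
have r0 : r = 0.
  apply/le_anti/andP; split; last first.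
    by rewrite rE; apply: Rintegral_ge0 => t _; exact: Q0.
  move: cvu; rewrite cE candidate_cost -EFinD lee_fin; lra.
have iQ0 : (\int[mu]_(t in `[a, b]) `|(EFin \o Q) t| = 0)%E.
  under eq_integral do rewrite /= ger0_norm//.
  by rewrite EFin_Rintegral// -rE r0.
have mQ : measurable_fun `[a, b] (EFin \o Q) by exact: measurable_int iQ.
have := (ae_eq_integral_abs mu (measurable_itv _) mQ).1 iQ0.
move=> aeQ; apply: ae_lebesgue1 aeQ => t Qt tab.
have [/eqP] : (Q t)%:E = 0%:E by apply: Qt; rewrite /= in_itv.
rewrite psumr_eq0 => [/allP h|k _]; last exact: sqr_ge0.
apply/eqP; rewrite -subr_eq0; apply/eqP/matrixP => i j.
rewrite (ord1 j) [RHS]mxE; apply/eqP.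
by have := h i (mem_index_enum _); rewrite sqrf_eq0.
Qed.

(** As the inputs agree almost everywhere, each pairing of a costate with [y - x] has zero
    derivative almost everywhere and keeps its value 0 from the left node. Letting the costate run
    over a basis gives Phi(t_i, t) (y - x) = 0, and Phi is invertible. [linear_ode_eq0] would ask
    for a derivative at every interior point. *)
Lemma optimal_unique (y v : R -> 'cV[R]_n) : optimal A B m tp xp y v ->
  forall i t, (i < m)%N -> tp i <= t <= tp i.+1 -> y t = x t.
Proof.
move=> /[dup] yv [[sy yn] _] i t im /andP[it ti].
have aew := optimal_control_unique yv.
have [sx xn] := candidate_admissible.
have tb := le_trans ti (qb im).
have tab : a <= t <= b by rewrite (le_trans (ap im) it).
have [acd dd] := solves_sub (ap im) it tb sy sx.
suff h (c' : 'cV[R]_n) : (c'^T *m Phi (tp i) t *m (y t - x t)) 0 0 = 0.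
  have P0 : Phi (tp i) t *m (y t - x t) = 0.
    apply/matrixP => k j; rewrite (ord1 j) [RHS]mxE.
    have := h (delta_mx k 0); rewrite trmx_delta -mulmxA -rowE mxE; exact.
  apply/eqP; rewrite -subr_eq0; apply/eqP.
  by rewrite -[_ - _]mul1mx -(transition_inv cA TP tab (pab im)) -mulmxA P0 mulmx0.
pose f := costate_pairing (tp i) Phi (fun t => y t - x t) c'.
have acf : abs_cont_on (tp i) t f.
  exact: (costate_pairing_abs_cont cA TP (ap im) it tb).
have df := costate_pairing_derive cA TP (ap im) it tb c' dd.
rewrite -[LHS]/(f t) (abs_cont_derive0 it acf).
  by rewrite /f /costate_pairing yn ?xn ?subrr ?mulmx0 ?mxE// ltnW.
apply: ae_lebesgue2 df aew => s fs ws /[dup] /fs ds /andP[is_ st].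
have sab : a <= s <= b.
  by rewrite (le_trans (ap im) (ltW is_)) (le_trans (ltW st) tb).
by move: ds; rewrite Bu// ws// subrr mulmx0 mxE.
Qed.

End optimum.

Theorem theorem3p2 (R : realType) (n m : nat) (tp : nat -> R)
    (xp : nat -> 'cV[R]_n) (A B : R -> 'M[R]_n) (Phi : R -> R -> 'M[R]_n) :
  (0 < m)%N ->
  (forall i, (i < m)%N -> tp i < tp i.+1) ->
  (* (H1) *) (forall t, tp 0%N <= t <= tp m -> B t \in unitmx) ->
  (* (H2) *) controllable A B (tp 0%N) (tp m) ->
  (* (H3) *) mx_C1_on (tp 0%N) (tp m) A -> mx_C1_on (tp 0%N) (tp m) B ->
  transition_matrix A (tp 0%N) (tp m) Phi ->
  let S i := mx_integral (tp i) (tp i.+1)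
               (fun s => Phi (tp i) s *m (Phi (tp i) s)^T) in
  let c i := invmx (S i) *m (Phi (tp i) (tp i.+1) *m xp i.+1 - xp i) in
  let xs i t := Phi t (tp i) *m xp i +
                mx_integral (tp i) t (fun s => Phi t s *m (Phi (tp i) s)^T) *m c i in
  let us i t := invmx (B t) *m (Phi (tp i) t)^T *m c i in
  let matches (x u : R -> 'cV[R]_n) :=
    forall i, (i < m)%N ->
      (forall t, tp i <= t <= tp i.+1 -> x t = xs i t) /\
      {ae (@lebesgue_measure R), forall t, tp i < t < tp i.+1 -> u t = us i t} in
  (exists x u, optimal A B m tp xp x u /\ matches x u) /\
  (forall x u, optimal A B m tp xp x u -> matches x u).

Proof.
move=> m0 tpS uB _ C1A C1B TP S c xs us matches.
have cA : mx_cont_on (tp 0%N) (tp m) A by move=> i j; have [] := C1A i j.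
have cB : mx_cont_on (tp 0%N) (tp m) B by move=> i j; have [] := C1B i j.
have [x [w xw]] := candidate_exists xp tpS cA TP.
have [xP wP _ _] := xw.
pose u t := invmx (B t) *m w t.
have xM i : (i < m)%N -> forall t, tp i <= t <= tp i.+1 -> x t = xs i t.
  by move=> im t tI; exact: xP.
have uM i t : (i < m)%N -> tp i < t < tp i.+1 -> u t = us i t.
  move=> im /andP[it ti]; rewrite /u (wP i)// ?it ?(ltW ti)//.
  by rewrite /us mulmxA.
have opt : optimal A B m tp xp x u by exact: (candidate_optimal tpS m0 uB cA cB TP xw).
split.
  exists x, u; split => // i im; split; first exact: xM.
  apply: ae_lebesgue1 (ae_neq (tp i)) => t _; exact: uM.
move=> y v yv i im; split.
  move=> t tI; rewrite -xM//.
  exact: (optimal_unique tpS m0 uB cA cB TP xw yv im tI).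
have aev := optimal_control_unique tpS m0 uB cA cB TP xw yv.
apply: ae_lebesgue1 aev => t vt /[dup] tI /andP[it ti].
have tab : tp 0%N <= t <= tp m.
  rewrite (le_trans (mesh_le tpS (leq0n i) (ltnW im)) (ltW it)).
  exact: le_trans (ltW ti) (mesh_le tpS im (leqnn m)).
by rewrite -uM// /u -vt// mulKmx// uB.
Qed.
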